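(* The Feynman category $\mathfrak F^{cyc}$ corepresenting cyclic operads is not a standard plus construction.
   Context: **Standard plus construction.** For a symmetric monoidal category $\mathcal M$, $\mathcal M^+$ is the symmetric monoidal category (product $\otimes$) obtained from the groupoid whose objects are the morphisms $\phi$ of $\mathcal M$ and whose morphisms are $(\sigma\Downarrow\sigma'):\phi\to\sigma'\phi\sigma^{-1}$ with $\sigma,\sigma'$ isomorphisms of $\mathcal M$, by adjoining $\bar\gamma_{\phi_1,\phi_0}:\phi_1\otimes\phi_0\to\phi_1\circ\phi_0$ for composable pairs, modulo outer equivariance $(\sigma\Downarrow\sigma')\bar\gamma_{\phi_1,\phi_0}=\bar\gamma_{\sigma'\phi_1,\phi_0\sigma^{-1}}[(id\Downarrow\sigma')\otimes(\sigma\Downarrow id)]$, inner equivariance $\bar\gamma_{\phi_1,\sigma\phi_0}[id\otimes(id\Downarrow\sigma)]=\bar\gamma_{\phi_1\sigma,\phi_0}[(\sigma^{-1}\Downarrow id)\otimes id]$, associativity, and interchange $\bar\gamma_{\phi_0\otimes\psi_0,\phi_1\otimes\psi_1}=\bar\gamma_{\phi_0,\phi_1}\otimes\bar\gamma_{\psi_0,\psi_1}$ (up to the evident commutativity constraint). A Feynman category ''is a standard plus construction'' if it is equivalent to $\mathcal M^+$ for some symmetric monoidal $\mathcal M$. **Feynman category**: $(\mathcal V,\mathcal F,\imath)$ with $\mathcal V$ a groupoid, $\mathcal F$ symmetric monoidal, $\imath:\mathcal V\to\mathcal F$, such that $\mathcal V^\boxtimes\simeq\mathrm{Iso}(\mathcal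 F)$, $\mathrm{Iso}(\mathcal F\downarrow\mathcal V)^\boxtimes\simeq\mathrm{Iso}(\mathcal F\downarrow\mathcal F)$ (free symmetric monoidal categories) and the slice categories are essentially small; basic morphisms have target in $\imath(\mathcal V)$. **$\mathfrak F^{cyc}$.** An (undirected) aggregate is $(V,F,\partial:F\to V)$ with $V,F$ finite sets of vertices and flags; a corolla is an aggregate with one vertex; monoidal product is disjoint union. A morphism is $(\phi_V,\phi^F,i_\phi)$ with $\phi_V:V\to V'$ surjective, $\phi^F:F'\to F$ injective, $i_\phi$ a fixed-point-free involution on $F\setminus\phi^F(F')$, such that $\phi_V\partial\phi^F=\partial'$ and $\phi_V\partial i_\phi=\phi_V\partial$ on $F\setminus\phi^F(F')$. Its ghost graph has vertices $V$, flags $F$ and edges the orbits of $i_\phi$. $\mathfrak F^{cyc}$ has $\mathcal V$ the groupoid of corollas and $\mathcal F$ the category of aggregates with morphisms those generated, under composition and disjoint union, by isomorphisms and basic morphisms whose ghost graph is a tree; it is generated by isomorphisms and edge contractions (ghost graph a one-edge tree). *)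

(* Defs.v *)
From Stdlib Require Import Setoid Morphisms.
From mathcomp Require Import all_boot.

Set Implicit Arguments.
Unset Strict Implicit.
Unset Printing Implicit Defensive.

Declare Scope cat_scope.
Delimit Scope cat_scope with cat.

(** * Symmetric monoidal categories *)

(* Each hom-type carries its own equality [heq], an equivalence relation; all
   categorical laws hold up to [heq].  Quotients of hom-sets, as needed for the
   plus construction, are then formed by choosing [heq].  Categories with
   Leibniz equality of morphisms are the special case [heq := eq]. *)
Record category := Category {
  obj :> Type;
  hom : obj -> obj -> Type;
  heq : forall X Y, hom X Y -> hom X Y -> Prop;
  idm : forall X, hom X X;
  comp : forall X Y Z, hom Y Z -> hom X Y -> hom X Z;
  heq_equiv : forall X Y, Equivalence (@heq X Y);
  comp_heq : forall X Y Z (g g' : hom Y Z) (f f' : hom X Y),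
    heq g g' -> heq f f' -> heq (comp g f) (comp g' f');
  compA : forall W X Y Z (h : hom Y Z) (g : hom X Y) (f : hom W X),
    heq (comp h (comp g f)) (comp (comp h g) f);
  comp1m : forall X Y (f : hom X Y), heq (comp (idm Y) f) f;
  compm1 : forall X Y (f : hom X Y), heq (comp f (idm X)) f
}.

Arguments heq {c X Y} _ _.
Arguments idm {c} X.
Arguments comp {c X Y Z} _ _.

Notation "f ≈ g" := (heq f g) (at level 70, no associativity) : cat_scope.
Notation "g ∘ f" := (comp g f) (at level 40, left associativity) : cat_scope.
Local Open Scope cat_scope.

#[global] Existing Instance heq_equiv.
#[global] Hint Extern 0 (heq _ _) => reflexivity : core.
#[global] Instance comp_proper (C : category) (X Y Z : C) :
  Proper (heq ==> heq ==> heq) (@comp C X Y Z).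
Proof. by move=> g g' eg f f' ef; apply: comp_heq. Qed.

Record iso (C : category) (X Y : C) := Iso {
  fwd :> hom X Y;
  bwd : hom Y X;
  bwdK : bwd ∘ fwd ≈ idm X;
  fwdK : fwd ∘ bwd ≈ idm Y
}.

Definition iso_id (C : category) (X : C) : iso X X :=
  Iso (comp1m (idm X)) (comp1m (idm X)).

Definition iso_inv (C : category) (X Y : C) (s : iso X Y) : iso Y X :=
  Iso (fwdK s) (bwdK s).

Lemma iso_comp_subproof (C : category) (X Y Z : C) (t : iso Y Z) (s : iso X Y) :
  (bwd s ∘ bwd t) ∘ (fwd t ∘ fwd s) ≈ idm X.
Proof.
by rewrite compA -(compA (bwd s)) bwdK compm1 bwdK.
Qed.

Definition iso_comp (C : category) (X Y Z : C) (t : iso Y Z) (s : iso X Y) :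
    iso X Z :=
  @Iso C X Z (fwd t ∘ fwd s) (bwd s ∘ bwd t) (iso_comp_subproof t s)
    (iso_comp_subproof (iso_inv s) (iso_inv t)).

Lemma iso_bwd_heq (C : category) (X Y : C) (s t : iso X Y) :
  fwd s ≈ fwd t -> bwd s ≈ bwd t.
Proof.
move=> e; rewrite -(compm1 (bwd s)) -(fwdK t) compA -e bwdK comp1m.
reflexivity.
Qed.

Record smcat := SMCat {
  smc_cat :> category;
  tens : smc_cat -> smc_cat -> smc_cat;
  unit_ob : smc_cat;
  tensm : forall A B A' B' : smc_cat,
    hom A A' -> hom B B' -> hom (tens A B) (tens A' B');
  assoc : forall A B C : smc_cat, iso (tens (tens A B) C) (tens A (tens B C));
  lunit : forall A : smc_cat, iso (tens unit_ob A) A;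
  runit : forall A : smc_cat, iso (tens A unit_ob) A;
  braid : forall A B : smc_cat, hom (tens A B) (tens B A);
  tensm_heq : forall (A B A' B' : smc_cat) (f f' : hom A A') (g g' : hom B B'),
    f ≈ f' -> g ≈ g' -> tensm f g ≈ tensm f' g';
  tensm_id : forall A B : smc_cat, tensm (idm A) (idm B) ≈ idm (tens A B);
  tensm_comp : forall (A B A' B' A'' B'' : smc_cat)
      (f' : hom A' A'') (g' : hom B' B'') (f : hom A A') (g : hom B B'),
    tensm (f' ∘ f) (g' ∘ g) ≈ tensm f' g' ∘ tensm f g;
  assoc_nat : forall (A B C A' B' C' : smc_cat)
      (f : hom A A') (g : hom B B') (h : hom C C'),
    assoc A' B' C' ∘ tensm (tensm f g) h
      ≈ tensm f (tensm g h) ∘ assoc A B C;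
  lunit_nat : forall (A A' : smc_cat) (f : hom A A'),
    lunit A' ∘ tensm (idm unit_ob) f ≈ f ∘ lunit A;
  runit_nat : forall (A A' : smc_cat) (f : hom A A'),
    runit A' ∘ tensm f (idm unit_ob) ≈ f ∘ runit A;
  braid_nat : forall (A B A' B' : smc_cat) (f : hom A A') (g : hom B B'),
    braid A' B' ∘ tensm f g ≈ tensm g f ∘ braid A B;
  triangle : forall A B : smc_cat,
    tensm (idm A) (lunit B) ∘ assoc A unit_ob B ≈ tensm (runit A) (idm B);
  pentagon : forall A B C D : smc_cat,
    tensm (idm A) (assoc B C D) ∘ assoc A (tens B C) D
        ∘ tensm (assoc A B C) (idm D)
      ≈ assoc A B (tens C D) ∘ assoc (tens A B) C D;
  hexagon : forall A B C : smc_cat,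
    assoc B C A ∘ braid A (tens B C) ∘ assoc A B C
      ≈ tensm (idm B) (braid A C) ∘ assoc B A C ∘ tensm (braid A B) (idm C);
  braid_sym : forall A B : smc_cat, braid B A ∘ braid A B ≈ idm (tens A B)
}.

Arguments tens {s} _ _.
Arguments unit_ob {s}.
Arguments tensm {s A B A' B'} _ _.
Arguments assoc {s} A B C.
Arguments lunit {s} A.
Arguments runit {s} A.
Arguments braid {s} A B.

Notation "A ⊗ B" := (tens A B) (at level 38, left associativity) : cat_scope.
Notation "f ⊠ g" := (tensm f g) (at level 38, left associativity) : cat_scope.
Notation "𝟙" := unit_ob : cat_scope.

#[global] Instance tensm_proper (C : smcat) (A B A' B' : C) :
  Proper (heq ==> heq ==> heq) (@tensm C A B A' B').
Proof. by move=> f f' ef g g' eg; exact: tensm_heq. Qed.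

Lemma iso_tens_subproof (C : smcat) (A B A' B' : C) (s : iso A A')
    (t : iso B B') :
  (bwd s ⊠ bwd t) ∘ (fwd s ⊠ fwd t) ≈ idm (A ⊗ B).
Proof. rewrite -tensm_comp !bwdK; exact: tensm_id. Qed.

Definition iso_tens (C : smcat) (A B A' B' : C) (s : iso A A') (t : iso B B') :
    iso (A ⊗ B) (A' ⊗ B') :=
  @Iso C (A ⊗ B) (A' ⊗ B') (fwd s ⊠ fwd t) (bwd s ⊠ bwd t)
    (iso_tens_subproof s t) (iso_tens_subproof (iso_inv s) (iso_inv t)).

Definition iso_braid (C : smcat) (A B : C) : iso (A ⊗ B) (B ⊗ A) :=
  Iso (braid_sym A B) (braid_sym B A).

Definition mid_four (C : smcat) (A B A' B' : C) :
    hom ((A ⊗ B) ⊗ (A' ⊗ B')) ((A ⊗ A') ⊗ (B ⊗ B')) :=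
  bwd (assoc A A' (B ⊗ B'))
    ∘ (idm A ⊠ (assoc A' B B' ∘ (braid B A' ⊠ idm B') ∘ bwd (assoc B A' B')))
    ∘ assoc A B (A' ⊗ B').

(** * Functors and equivalences *)

Record functor (C D : category) := Functor {
  fob :> C -> D;
  fmap : forall X Y : C, hom X Y -> hom (fob X) (fob Y);
  fmap_heq : forall (X Y : C) (f f' : hom X Y), f ≈ f' -> fmap f ≈ fmap f';
  fmap_id : forall X : C, fmap (idm X) ≈ idm (fob X);
  fmap_comp : forall (X Y Z : C) (g : hom Y Z) (f : hom X Y),
    fmap (g ∘ f) ≈ fmap g ∘ fmap f
}.

Arguments fmap {C D} _ {X Y} _.

Definition functor_id (C : category) : functor C C :=
  @Functor C C (fun X => X) (fun _ _ f => f) (fun _ _ _ _ e => e)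
    (fun X => reflexivity (idm X)) (fun _ _ _ g f => reflexivity (g ∘ f)).

Lemma functor_comp_id (C D E : category) (G : functor D E) (F : functor C D)
    (X : C) :
  fmap G (fmap F (idm X)) ≈ idm (G (F X)).
Proof. by rewrite (fmap_heq G (fmap_id F X)); exact: fmap_id. Qed.

Lemma functor_comp_comp (C D E : category) (G : functor D E) (F : functor C D)
    (X Y Z : C) (g : hom Y Z) (f : hom X Y) :
  fmap G (fmap F (g ∘ f)) ≈ fmap G (fmap F g) ∘ fmap G (fmap F f).
Proof. by rewrite (fmap_heq G (fmap_comp F g f)); exact: fmap_comp. Qed.

Definition functor_comp (C D E : category) (G : functor D E)
    (F : functor C D) : functor C E :=
  @Functor C E (fun X => G (F X)) (fun _ _ f => fmap G (fmap F f))
    (fun _ _ _ _ e => fmap_heq G (fmap_heq F e))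
    (functor_comp_id G F) (functor_comp_comp G F).

Record nat_iso (C D : category) (F G : functor C D) := NatIso {
  ncomp :> forall X : C, iso (F X) (G X);
  ncomp_nat : forall (X Y : C) (f : hom X Y),
    ncomp Y ∘ fmap F f ≈ fmap G f ∘ ncomp X
}.

Definition is_equivalence (C D : category) (F : functor C D) : Prop :=
  exists G : functor D C,
    inhabited (nat_iso (functor_comp G F) (functor_id C)) /\
    inhabited (nat_iso (functor_comp F G) (functor_id D)).

Record smfunctor (C D : smcat) := SMFunctor {
  smf_functor :> functor C D;
  smf_tens : forall X Y : C,
    iso (smf_functor X ⊗ smf_functor Y) (smf_functor (X ⊗ Y));
  smf_unit : iso (𝟙 : D) (smf_functor 𝟙);
  smf_tens_nat : forall (X Y X' Y' : C) (f : hom X X') (g : hom Y Y'),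
    smf_tens X' Y' ∘ (fmap smf_functor f ⊠ fmap smf_functor g)
      ≈ fmap smf_functor (f ⊠ g) ∘ smf_tens X Y;
  smf_assoc : forall X Y Z : C,
    fmap smf_functor (assoc X Y Z) ∘ smf_tens (X ⊗ Y) Z
        ∘ (smf_tens X Y ⊠ idm (smf_functor Z))
      ≈ smf_tens X (Y ⊗ Z) ∘ (idm (smf_functor X) ⊠ smf_tens Y Z)
        ∘ assoc (smf_functor X) (smf_functor Y) (smf_functor Z);
  smf_lunit : forall X : C,
    fmap smf_functor (lunit X) ∘ smf_tens 𝟙 X
        ∘ (smf_unit ⊠ idm (smf_functor X))
      ≈ lunit (smf_functor X);
  smf_runit : forall X : C,
    fmap smf_functor (runit X) ∘ smf_tens X 𝟙
        ∘ (idm (smf_functor X) ⊠ smf_unit)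
      ≈ runit (smf_functor X);
  smf_braid : forall X Y : C,
    fmap smf_functor (braid X Y) ∘ smf_tens X Y
      ≈ smf_tens Y X ∘ braid (smf_functor X) (smf_functor Y)
}.

Definition sm_equivalent (C D : smcat) : Prop :=
  exists F : smfunctor C D, is_equivalence F.

(** * The standard plus construction *)

Record arr (M : category) := Arr {
  src : M;
  tgt : M;
  arrow : hom src tgt
}.

Arguments Arr {M src tgt} arrow.

(* [ArrIso σ σ' _] is the isomorphism (σ ⇓ σ') : φ → ψ where
   ψ ≈ σ' ∘ φ ∘ σ^-1; the target is only pinned down up to [≈]. *)
Record arr_iso (M : category) (φ ψ : arr M) := ArrIso {
  iso_src : iso (src φ) (src ψ);
  iso_tgt : iso (tgt φ) (tgt ψ);
  iso_sq : arrow ψ ∘ iso_src ≈ iso_tgt ∘ arrow φ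
}.

Definition arr_heq (M : category) (φ ψ : arr M) (s t : arr_iso φ ψ) : Prop :=
  fwd (iso_src s) ≈ fwd (iso_src t) /\ fwd (iso_tgt s) ≈ fwd (iso_tgt t).

Lemma arr_id_subproof (M : category) (φ : arr M) :
  arrow φ ∘ iso_id (src φ) ≈ iso_id (tgt φ) ∘ arrow φ.
Proof. by rewrite compm1 comp1m. Qed.

Definition arr_id (M : category) (φ : arr M) : arr_iso φ φ :=
  ArrIso (arr_id_subproof φ).

Lemma arr_comp_subproof (M : category) (φ ψ χ : arr M)
    (t : arr_iso ψ χ) (s : arr_iso φ ψ) :
  arrow χ ∘ iso_comp (iso_src t) (iso_src s)
    ≈ iso_comp (iso_tgt t) (iso_tgt s) ∘ arrow φ.
Proof. by rewrite /= compA iso_sq -compA iso_sq compA. Qed.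

Definition arr_comp (M : category) (φ ψ χ : arr M)
    (t : arr_iso ψ χ) (s : arr_iso φ ψ) : arr_iso φ χ :=
  ArrIso (arr_comp_subproof t s).

Lemma arr_inv_subproof (M : category) (φ ψ : arr M) (s : arr_iso φ ψ) :
  arrow φ ∘ iso_inv (iso_src s) ≈ iso_inv (iso_tgt s) ∘ arrow ψ.
Proof.
rewrite /= -{1}(comp1m (arrow φ)) -(bwdK (iso_tgt s)) -(compA _ _ (arrow φ)).
by rewrite -iso_sq -compA -(compA _ _ (bwd _)) fwdK compm1.
Qed.

Definition arr_inv (M : category) (φ ψ : arr M) (s : arr_iso φ ψ) :
    arr_iso ψ φ :=
  ArrIso (arr_inv_subproof s).

Lemma arr_equiv (M : category) (φ ψ : arr M) : Equivalence (@arr_heq M φ ψ).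
Proof.
split.
- by move=> s; split; reflexivity.
- by move=> s t [e1 e2]; split; symmetry.
- by move=> s t u [e1 e2] [e3 e4]; split; [rewrite e1 | rewrite e2].
Qed.

Definition arr_cat (M : category) : category.
Proof.
refine (@Category (arr M) (@arr_iso M) (@arr_heq M) (@arr_id M) (@arr_comp M)
  (@arr_equiv M) _ _ _ _).
- move=> φ ψ χ t t' s s' [e1 e2] [e3 e4].
  by split; rewrite /= ?e1 ?e2 ?e3 ?e4; reflexivity.
- by move=> *; split; exact: compA.
- by move=> *; split; exact: comp1m.
- by move=> *; split; exact: compm1.
Defined.

Definition arr_tens (M : smcat) (φ ψ : arr M) : arr M :=
  Arr (arrow φ ⊠ arrow ψ).

Lemma arr_tensm_subproof (M : smcat) (φ ψ φ' ψ' : arr M)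
    (s : arr_iso φ φ') (t : arr_iso ψ ψ') :
  arrow (arr_tens φ' ψ') ∘ iso_tens (iso_src s) (iso_src t)
    ≈ iso_tens (iso_tgt s) (iso_tgt t) ∘ arrow (arr_tens φ ψ).
Proof. by rewrite /= -!tensm_comp !iso_sq. Qed.

Definition arr_tensm (M : smcat) (φ ψ φ' ψ' : arr M)
    (s : arr_iso φ φ') (t : arr_iso ψ ψ') :
    arr_iso (arr_tens φ ψ) (arr_tens φ' ψ') :=
  @ArrIso M (arr_tens φ ψ) (arr_tens φ' ψ')
    (iso_tens (iso_src s) (iso_src t)) (iso_tens (iso_tgt s) (iso_tgt t))
    (arr_tensm_subproof s t).

Definition arr_unit (M : smcat) : arr M := Arr (idm (𝟙 : M)).

Lemma arr_to_iso_subproof (M : category) (φ ψ : arr_cat M) (s : arr_iso φ ψ) :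
  (arr_inv s : @hom (arr_cat M) ψ φ) ∘ (s : @hom (arr_cat M) φ ψ) ≈ idm φ.
Proof. by split; exact: bwdK. Qed.

Lemma arr_to_iso_subproof2 (M : category) (φ ψ : arr_cat M) (s : arr_iso φ ψ) :
  (s : @hom (arr_cat M) φ ψ) ∘ (arr_inv s : @hom (arr_cat M) ψ φ) ≈ idm ψ.
Proof. by split; exact: fwdK. Qed.

Definition arr_to_iso (M : category) (φ ψ : arr_cat M) (s : arr_iso φ ψ) :
    iso φ ψ :=
  Iso (arr_to_iso_subproof s) (arr_to_iso_subproof2 s).

Definition arr_assoc (M : smcat) (φ ψ χ : arr M) :
    arr_iso (arr_tens (arr_tens φ ψ) χ) (arr_tens φ (arr_tens ψ χ)) :=
  @ArrIso M (arr_tens (arr_tens φ ψ) χ) (arr_tens φ (arr_tens ψ χ))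
    (assoc (src φ) (src ψ) (src χ)) (assoc (tgt φ) (tgt ψ) (tgt χ))
    (symmetry (assoc_nat (arrow φ) (arrow ψ) (arrow χ))).

Definition arr_lunit (M : smcat) (φ : arr M) :
    arr_iso (arr_tens (arr_unit M) φ) φ :=
  @ArrIso M (arr_tens (arr_unit M) φ) φ (lunit (src φ)) (lunit (tgt φ))
    (symmetry (lunit_nat (arrow φ))).

Definition arr_runit (M : smcat) (φ : arr M) :
    arr_iso (arr_tens φ (arr_unit M)) φ :=
  @ArrIso M (arr_tens φ (arr_unit M)) φ (runit (src φ)) (runit (tgt φ))
    (symmetry (runit_nat (arrow φ))).

Definition arr_braid (M : smcat) (φ ψ : arr M) :
    arr_iso (arr_tens φ ψ) (arr_tens ψ φ) :=
  @ArrIso M (arr_tens φ ψ) (arr_tens ψ φ)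
    (iso_braid (src φ) (src ψ)) (iso_braid (tgt φ) (tgt ψ))
    (symmetry (braid_nat (arrow φ) (arrow ψ))).

(* The groupoid of morphisms of [M] and the isomorphisms (σ ⇓ σ'). *)
Definition arr_smc (M : smcat) : smcat.
Proof.
refine (@SMCat (arr_cat M) (@arr_tens M) (arr_unit M) (@arr_tensm M)
  (fun φ ψ χ => arr_to_iso (arr_assoc φ ψ χ))
  (fun φ => arr_to_iso (arr_lunit φ)) (fun φ => arr_to_iso (arr_runit φ))
  (@arr_braid M) _ _ _ _ _ _ _ _ _ _ _).
- by move=> A B A' B' f f' g g' [e1 e2] [e3 e4]; split; exact: tensm_heq.
- by move=> *; split; exact: tensm_id.
- by move=> *; split; exact: tensm_comp.
- by move=> *; split; exact: assoc_nat.
- by move=> *; split; exact: lunit_nat.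
- by move=> *; split; exact: runit_nat.
- by move=> *; split; exact: braid_nat.
- by move=> *; split; exact: triangle.
- by move=> *; split; exact: pentagon.
- by move=> *; split; exact: hexagon.
- by move=> *; split; exact: braid_sym.
Defined.

Definition arr_cast (M : category) (X Y : M) (f f' : hom X Y) (e : f ≈ f') :
    arr_iso (Arr f) (Arr f').
Proof.
apply: (@ArrIso M (Arr f) (Arr f') (iso_id X) (iso_id Y)).
by rewrite /= compm1 comp1m; symmetry.
Defined.

(* (id ⇓ σ') : φ → σ' ∘ φ *)
Definition arr_post (M : category) (X Y Y' : M) (f : hom X Y) (s : iso Y Y') :
    arr_iso (Arr f) (Arr (s ∘ f)).
Proof.
apply: (@ArrIso M (Arr f) (Arr (s ∘ f)) (iso_id X) s).
exact: compm1.
Defined.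

(* (σ ⇓ id) : φ → φ ∘ σ^-1 *)
Definition arr_pre (M : category) (X X' Y : M) (f : hom X Y) (s : iso X X') :
    arr_iso (Arr f) (Arr (f ∘ bwd s)).
Proof.
apply: (@ArrIso M (Arr f) (Arr (f ∘ bwd s)) s (iso_id Y)).
by rewrite /= -compA bwdK compm1 comp1m.
Defined.

(* (σ ⇓ σ') : φ1 ∘ φ0 → (σ' ∘ φ1) ∘ (φ0 ∘ σ^-1) *)
Definition arr_outer (M : category) (X X' Y Z Z' : M)
    (g : hom Y Z) (f : hom X Y) (s : iso X X') (s' : iso Z Z') :
    arr_iso (Arr (g ∘ f)) (Arr ((s' ∘ g) ∘ (f ∘ bwd s))).
Proof.
apply: (@ArrIso M (Arr (g ∘ f)) (Arr ((s' ∘ g) ∘ (f ∘ bwd s))) s s').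
by rewrite /= -!compA bwdK compm1.
Defined.

Inductive plus_hom (M : smcat) : arr M -> arr M -> Type :=
| plus_iso φ ψ : arr_iso φ ψ -> plus_hom φ ψ
| plus_gamma (X Y Z : M) (g : hom Y Z) (f : hom X Y) :
    plus_hom (arr_tens (Arr g) (Arr f)) (Arr (g ∘ f))
| plus_comp φ ψ χ : plus_hom ψ χ -> plus_hom φ ψ -> plus_hom φ χ
| plus_tens φ ψ φ' ψ' :
    plus_hom φ φ' -> plus_hom ψ ψ' ->
    plus_hom (arr_tens φ ψ) (arr_tens φ' ψ').

Notation plus_id φ := (plus_iso (arr_id φ)).

(* The congruence presenting [plus]: first the laws making [plus_hom] a
   symmetric monoidal category receiving [arr_smc M] strictly, then the
   relations on the [plus_gamma].  Targets that agree only up to [≈] in [M] are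
   identified by [arr_cast], and [plus_gamma_cast] says that γ depends only on
   the classes of its arguments.  Interchange is compatibility of γ with the
   tensor product of [M]; [plus_interchange_unit] is its instance for the empty
   tensor product.  Without it γ_{id_𝟙,id_𝟙} would give a nontrivial
   endomorphism of the unit for every [M], and no [plus M] would be a Feynman
   category. *)
Inductive plus_heq (M : smcat) :
    forall φ ψ : arr M, plus_hom φ ψ -> plus_hom φ ψ -> Prop :=
| plus_refl φ ψ (a : plus_hom φ ψ) : plus_heq a a
| plus_symm φ ψ (a b : plus_hom φ ψ) : plus_heq a b -> plus_heq b a
| plus_trans φ ψ (a b c : plus_hom φ ψ) :
    plus_heq a b -> plus_heq b c -> plus_heq a c
| plus_comp_heq φ ψ χ (b b' : plus_hom ψ χ) (a a' : plus_hom φ ψ) :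
    plus_heq b b' -> plus_heq a a' ->
    plus_heq (plus_comp b a) (plus_comp b' a')
| plus_compA φ ψ χ ω (c : plus_hom χ ω) (b : plus_hom ψ χ)
    (a : plus_hom φ ψ) :
    plus_heq (plus_comp c (plus_comp b a)) (plus_comp (plus_comp c b) a)
| plus_comp1m φ ψ (a : plus_hom φ ψ) : plus_heq (plus_comp (plus_id ψ) a) a
| plus_compm1 φ ψ (a : plus_hom φ ψ) : plus_heq (plus_comp a (plus_id φ)) a
| plus_tens_heq φ ψ φ' ψ' (a a' : plus_hom φ φ') (b b' : plus_hom ψ ψ') :
    plus_heq a a' -> plus_heq b b' ->
    plus_heq (plus_tens a b) (plus_tens a' b')
| plus_tens_comp φ ψ φ' ψ' φ'' ψ'' (a' : plus_hom φ' φ'')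
    (b' : plus_hom ψ' ψ'') (a : plus_hom φ φ') (b : plus_hom ψ ψ') :
    plus_heq (plus_tens (plus_comp a' a) (plus_comp b' b))
             (plus_comp (plus_tens a' b') (plus_tens a b))
| plus_iso_heq φ ψ (s t : arr_iso φ ψ) :
    arr_heq s t -> plus_heq (plus_iso s) (plus_iso t)
| plus_iso_comp φ ψ χ (t : arr_iso ψ χ) (s : arr_iso φ ψ) :
    plus_heq (plus_iso (arr_comp t s)) (plus_comp (plus_iso t) (plus_iso s))
| plus_iso_tens φ ψ φ' ψ' (s : arr_iso φ φ') (t : arr_iso ψ ψ') :
    plus_heq (plus_iso (arr_tensm s t)) (plus_tens (plus_iso s) (plus_iso t))
| plus_assoc_nat φ ψ χ φ' ψ' χ' (a : plus_hom φ φ') (b : plus_hom ψ ψ')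
    (c : plus_hom χ χ') :
    plus_heq
      (plus_comp (plus_iso (arr_assoc φ' ψ' χ')) (plus_tens (plus_tens a b) c))
      (plus_comp (plus_tens a (plus_tens b c)) (plus_iso (arr_assoc φ ψ χ)))
| plus_lunit_nat φ φ' (a : plus_hom φ φ') :
    plus_heq
      (plus_comp (plus_iso (arr_lunit φ')) (plus_tens (plus_id (arr_unit M)) a))
      (plus_comp a (plus_iso (arr_lunit φ)))
| plus_runit_nat φ φ' (a : plus_hom φ φ') :
    plus_heq
      (plus_comp (plus_iso (arr_runit φ')) (plus_tens a (plus_id (arr_unit M))))
      (plus_comp a (plus_iso (arr_runit φ)))
| plus_braid_nat φ ψ φ' ψ' (a : plus_hom φ φ') (b : plus_hom ψ ψ') :
    plus_heq
      (plus_comp (plus_iso (arr_braid φ' ψ')) (plus_tens a b))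
      (plus_comp (plus_tens b a) (plus_iso (arr_braid φ ψ)))
| plus_gamma_cast (X Y Z : M) (g g' : hom Y Z) (f f' : hom X Y)
    (eg : g ≈ g') (ef : f ≈ f') :
    plus_heq
      (plus_comp (plus_iso (arr_cast (comp_heq eg ef))) (plus_gamma g f))
      (plus_comp (plus_gamma g' f')
        (plus_tens (plus_iso (arr_cast eg)) (plus_iso (arr_cast ef))))
| plus_outer (X X' Y Z Z' : M) (g : hom Y Z) (f : hom X Y)
    (s : iso X X') (s' : iso Z Z') :
    plus_heq
      (plus_comp (plus_iso (arr_outer g f s s')) (plus_gamma g f))
      (plus_comp (plus_gamma (s' ∘ g) (f ∘ bwd s))
        (plus_tens (plus_iso (arr_post g s')) (plus_iso (arr_pre f s))))
| plus_inner (X Y Y' Z : M) (g : hom Y' Z) (f : hom X Y) (s : iso Y Y') :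
    plus_heq
      (plus_comp (plus_iso (arr_cast (compA g s f)))
        (plus_comp (plus_gamma g (s ∘ f))
          (plus_tens (plus_id (Arr g)) (plus_iso (arr_post f s)))))
      (plus_comp (plus_gamma (g ∘ s) f)
        (plus_tens (plus_iso (arr_pre g (iso_inv s))) (plus_id (Arr f))))
| plus_gammaA (W X Y Z : M) (h : hom Y Z) (g : hom X Y) (f : hom W X) :
    plus_heq
      (plus_comp (plus_iso (arr_cast (compA h g f)))
        (plus_comp (plus_gamma h (g ∘ f))
          (plus_comp (plus_tens (plus_id (Arr h)) (plus_gamma g f))
            (plus_iso (arr_assoc (Arr h) (Arr g) (Arr f))))))
      (plus_comp (plus_gamma (h ∘ g) f)
        (plus_tens (plus_gamma h g) (plus_id (Arr f))))
| plus_interchange (X Y Z X' Y' Z' : M) (g : hom Y Z) (f : hom X Y)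
    (g' : hom Y' Z') (f' : hom X' Y') :
    plus_heq
      (plus_gamma (g ⊠ g') (f ⊠ f'))
      (plus_comp (plus_iso (arr_cast (tensm_comp g g' f f')))
        (plus_comp (plus_tens (plus_gamma g f) (plus_gamma g' f'))
          (plus_iso (@mid_four (arr_smc M) (Arr g) (Arr g') (Arr f) (Arr f')))))
| plus_interchange_unit :
    plus_heq
      (plus_comp (plus_iso (arr_cast (comp1m (idm 𝟙))))
        (plus_gamma (idm (𝟙 : M)) (idm (𝟙 : M))))
      (plus_iso (arr_lunit (arr_unit M))).

Lemma plus_equiv (M : smcat) (φ ψ : arr M) : Equivalence (@plus_heq M φ ψ).
Proof.
split; first exact: plus_refl.
  exact: plus_symm.
exact: plus_trans.
Qed.

Definition plus_cat (M : smcat) : category :=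
  @Category (arr M) (@plus_hom M) (@plus_heq M) (fun φ => plus_id φ)
    (@plus_comp M) (@plus_equiv M) (@plus_comp_heq M) (@plus_compA M)
    (@plus_comp1m M) (@plus_compm1 M).

Lemma plus_of_arr (M : smcat) (φ ψ χ : arr M) (t : arr_iso ψ χ)
    (s : arr_iso φ ψ) (u : arr_iso φ χ) :
  arr_heq (arr_comp t s) u ->
  plus_heq (plus_comp (plus_iso t) (plus_iso s)) (plus_iso u).
Proof.
move=> e; apply: plus_trans (plus_iso_heq e).
apply: plus_symm; exact: plus_iso_comp.
Qed.

Definition plus_of_iso (M : smcat) (φ ψ : plus_cat M) (s : arr_iso φ ψ) :
    iso φ ψ :=
  @Iso (plus_cat M) φ ψ (plus_iso s) (plus_iso (arr_inv s))
    (plus_of_arr (arr_to_iso_subproof s))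
    (plus_of_arr (arr_to_iso_subproof2 s)).

Definition plus (M : smcat) : smcat.
Proof.
refine (@SMCat (plus_cat M) (@arr_tens M) (arr_unit M) (@plus_tens M)
  (fun φ ψ χ => plus_of_iso (arr_assoc φ ψ χ))
  (fun φ => plus_of_iso (arr_lunit φ)) (fun φ => plus_of_iso (arr_runit φ))
  (fun φ ψ => plus_iso (arr_braid φ ψ))
  (@plus_tens_heq M) _ (@plus_tens_comp M) (@plus_assoc_nat M)
  (@plus_lunit_nat M) (@plus_runit_nat M) (@plus_braid_nat M) _ _ _ _).
- move=> φ ψ; apply: plus_trans (plus_symm (plus_iso_tens _ _)) _.
  apply: plus_iso_heq; exact: (@tensm_id (arr_smc M)).
- move=> φ ψ; apply: plus_trans.
    exact: plus_comp_heq (plus_symm (plus_iso_tens _ _)) (plus_refl _).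
  apply: plus_trans (plus_iso_tens _ _); apply: plus_of_arr.
  exact: (@triangle (arr_smc M)).
- move=> φ ψ χ ω; apply: plus_trans.
    apply: plus_comp_heq (plus_symm (plus_iso_tens _ _)).
    exact: plus_comp_heq (plus_symm (plus_iso_tens _ _)) (plus_refl _).
  apply: plus_trans (plus_iso_comp _ _); apply: plus_trans.
    exact: plus_comp_heq (plus_symm (plus_iso_comp _ _)) (plus_refl _).
  apply: plus_of_arr; exact: (@pentagon (arr_smc M)).
- move=> φ ψ χ; apply: plus_trans.
    exact: plus_comp_heq (plus_symm (plus_iso_comp _ _)) (plus_refl _).
  apply: plus_trans.
    exact: (plus_symm (plus_iso_comp _ _)).
  apply: plus_symm; apply: plus_trans.
    apply: plus_comp_heq (plus_symm (plus_iso_tens _ _)).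
    exact: plus_comp_heq (plus_symm (plus_iso_tens _ _)) (plus_refl _).
  apply: plus_trans.
    exact: plus_comp_heq (plus_symm (plus_iso_comp _ _)) (plus_refl _).
  apply: plus_of_arr.
  exact: (symmetry (@hexagon (arr_smc M) φ ψ χ)).
- move=> φ ψ; apply: plus_of_arr; exact: (@braid_sym (arr_smc M)).
Defined.

(** * Wide subcategories and subgroupoids *)

Inductive generated (C : smcat) (B : forall X Y : C, hom X Y -> Prop) :
    forall X Y : C, hom X Y -> Prop :=
| gen_iso X Y (s : iso X Y) : generated B s
| gen_base X Y (f : hom X Y) : B X Y f -> generated B f
| gen_comp X Y Z (g : hom Y Z) (f : hom X Y) :
    generated B g -> generated B f -> generated B (g ∘ f)
| gen_tens X Y X' Y' (f : hom X X') (g : hom Y Y') :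
    generated B f -> generated B g -> generated B (f ⊠ g)
| gen_heq X Y (f g : hom X Y) : f ≈ g -> generated B f -> generated B g.

Definition sub_hom (C : smcat) (B : forall X Y : C, hom X Y -> Prop)
    (X Y : C) : Type :=
  {f : hom X Y | generated B f}.

Lemma sub_equiv (C : smcat) (B : forall X Y : C, hom X Y -> Prop) (X Y : C) :
  Equivalence (fun f g : sub_hom B X Y => sval f ≈ sval g).
Proof.
split; first by move=> f.
  by move=> f g e; symmetry.
by move=> f g h e1 e2; rewrite e1.
Qed.

Definition sub_cat (C : smcat) (B : forall X Y : C, hom X Y -> Prop) :
    category.
Proof.
refine (@Category C (sub_hom B) (fun X Y f g => sval f ≈ sval g)
  (fun X => exist _ (idm X) (gen_iso B (iso_id X)))
  (fun X Y Z g f => exist _ (sval g ∘ sval f)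
     (gen_comp (svalP g) (svalP f)))
  (@sub_equiv C B) _ _ _ _).
- by move=> *; apply: comp_heq.
- by move=> *; apply: compA.
- by move=> *; apply: comp1m.
- by move=> *; apply: compm1.
Defined.

Definition sub_iso (C : smcat) (B : forall X Y : C, hom X Y -> Prop)
    (X Y : C) (s : iso X Y) : @iso (sub_cat B) X Y :=
  @Iso (sub_cat B) X Y (exist _ (fwd s) (gen_iso B s))
    (exist _ (bwd s) (gen_iso B (iso_inv s))) (bwdK s) (fwdK s).

(* The wide symmetric monoidal subcategory generated by [B] and all
   isomorphisms. *)
Definition generated_smc (C : smcat) (B : forall X Y : C, hom X Y -> Prop) :
    smcat.
Proof.
refine (@SMCat (sub_cat B) (@tens C) (@unit_ob C)
  (fun X Y X' Y' f g => exist _ (sval f ⊠ sval g)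
     (gen_tens (svalP f) (svalP g)))
  (fun X Y Z => sub_iso B (assoc X Y Z))
  (fun X => sub_iso B (lunit X)) (fun X => sub_iso B (runit X))
  (fun X Y => fwd (sub_iso B (iso_braid X Y))) _ _ _ _ _ _ _ _ _ _ _).
- by move=> *; apply: tensm_heq.
- by move=> *; apply: tensm_id.
- by move=> *; apply: tensm_comp.
- by move=> *; apply: assoc_nat.
- by move=> *; apply: lunit_nat.
- by move=> *; apply: runit_nat.
- by move=> *; apply: braid_nat.
- by move=> *; apply: triangle.
- by move=> *; apply: pentagon.
- by move=> *; apply: hexagon.
- by move=> *; apply: braid_sym.
Defined.

Lemma iso_heq_equiv (C : category) (X Y : C) :
  Equivalence (fun s t : iso X Y => fwd s ≈ fwd t).
Proof.
split; first by move=> f.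
  by move=> f g e; symmetry.
by move=> f g h e1 e2; rewrite e1.
Qed.

(* The groupoid of isomorphisms of [C] between objects satisfying [P]. *)
Definition groupoid_on (C : category) (P : C -> Prop) : category.
Proof.
refine (@Category {X : C | P X} (fun X Y => iso (sval X) (sval Y))
  (fun X Y s t => fwd s ≈ fwd t) (fun X => iso_id (sval X))
  (fun X Y Z t s => iso_comp t s) (fun X Y => iso_heq_equiv (sval X) (sval Y))
  _ _ _ _).
- by move=> *; apply: comp_heq.
- by move=> *; apply: compA.
- by move=> *; apply: comp1m.
- by move=> *; apply: compm1.
Defined.

Definition groupoid_incl (C : category) (P : C -> Prop) :
    functor (groupoid_on P) C :=
  @Functor (groupoid_on P) C (fun X => sval X) (fun X Y s => fwd s)
    (fun X Y s t e => e) (fun X => reflexivity (idm (sval X)))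
    (fun X Y Z t s => reflexivity (fwd t ∘ fwd s)).

Lemma groupoid_on_inv (C : category) (P : C -> Prop) (X Y : groupoid_on P)
    (s : hom X Y) :
  exists t : hom Y X, t ∘ s ≈ idm X /\ s ∘ t ≈ idm Y.
Proof. by exists (iso_inv s); split; [apply: bwdK | apply: fwdK]. Qed.

(* The data (V, F, ι) of a Feynman category.  Its axioms are not part of the
   record: whether such a triple is a standard plus construction only depends on
   the data. *)
Record feynman_data := FeynmanData {
  fc_vert : category;
  fc_vert_inv : forall (X Y : fc_vert) (s : hom X Y),
    exists t : hom Y X, t ∘ s ≈ idm X /\ s ∘ t ≈ idm Y;
  fc_mor : smcat;
  fc_incl : functor fc_vert fc_mor
}.

Definition is_standard_plus (F : feynman_data) : Prop :=
  exists M : smcat, sm_equivalent (plus M) (fc_mor F).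

(** * Aggregates *)

Record aggregate := Aggregate {
  vert : finType;
  flag : finType;
  bd : flag -> vert
}.

Arguments bd {a} _.

(* The involution i_φ on the flags outside the image of φ^F is extended to all
   flags by the identity on that image; as i_φ has no fixed points, the image of
   φ^F is then exactly the set of fixed points of [mI]. *)
Record agg_mor (X Y : aggregate) := AggMor {
  mV : vert X -> vert Y;
  mF : flag Y -> flag X;
  mI : flag X -> flag X;
  mV_surj : forall w, exists v, mV v = w;
  mF_inj : injective mF;
  mI_invol : involutive mI;
  mI_fix : forall x, (mI x == x) = (x \in codom mF);
  mV_bd : forall y, mV (bd (mF y)) = bd y;
  mI_bd : forall x, mV (bd (mI x)) = mV (bd x)
}.

Definition agg_heq (X Y : aggregate) (f g : agg_mor X Y) : Prop :=
  [/\ mV f =1 mV g, mF f =1 mF g & mI f =1 mI g].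

Lemma agg_equiv (X Y : aggregate) : Equivalence (@agg_heq X Y).
Proof.
split; first by [].
  by move=> f g [e1 e2 e3]; split=> x.
by move=> f g h [e1 e2 e3] [e4 e5 e6]; split=> x; rewrite ?e1 ?e2 ?e3.
Qed.

Lemma mI_mF (X Y : aggregate) (f : agg_mor X Y) y : mI f (mF f y) = mF f y.
Proof. by apply/eqP; rewrite mI_fix codom_f. Qed.

Lemma mI_codom (X Y : aggregate) (f : agg_mor X Y) x :
  (mI f x \in codom (mF f)) = (x \in codom (mF f)).
Proof. by rewrite -!mI_fix mI_invol eq_sym. Qed.

(* i_{g ∘ f}: the edges of [f] together with the edges of [g]. *)
Definition glue (X Y Z : aggregate) (g : agg_mor Y Z) (f : agg_mor X Y)
    (x : flag X) : flag X :=
  if [pick y | mF f y == x] is Some y then mF f (mI g y) else mI f x.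

Lemma glue_in (X Y Z : aggregate) (g : agg_mor Y Z) (f : agg_mor X Y) y :
  glue g f (mF f y) = mF f (mI g y).
Proof.
rewrite /glue; case: pickP => [z /eqP/mF_inj -> //|/(_ y)].
by rewrite eqxx.
Qed.

Lemma glue_out (X Y Z : aggregate) (g : agg_mor Y Z) (f : agg_mor X Y) x :
  x \notin codom (mF f) -> glue g f x = mI f x.
Proof.
rewrite /glue; case: pickP => [z /eqP <-|//]; by rewrite codom_f.
Qed.

Definition agg_comp (X Y Z : aggregate) (g : agg_mor Y Z) (f : agg_mor X Y) :
    agg_mor X Z.
Proof.
refine (@AggMor X Z (mV g \o mV f) (mF f \o mF g) (glue g f) _ _ _ _ _ _).
- move=> w; have [v <-] := mV_surj g w; have [u <-] := mV_surj f v.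
  by exists u.
- exact: inj_comp (@mF_inj _ _ f) (@mF_inj _ _ g).
- move=> x; have [/codomP[y ->]|xN] := boolP (x \in codom (mF f)).
    by rewrite !glue_in mI_invol.
  by rewrite (glue_out _ xN) glue_out ?mI_codom // mI_invol.
- move=> x; have [/codomP[y ->]|xN] := boolP (x \in codom (mF f)).
    rewrite glue_in (inj_eq (@mF_inj _ _ f)) mI_fix.
    apply/codomP/codomP => [[z ->]|[z /= /mF_inj ->]]; by exists z.
  rewrite glue_out // mI_fix (negPf xN); symmetry; apply/negbTE.
  apply: contra xN => /codomP[z ->]; exact: codom_f.
- by move=> y /=; rewrite !mV_bd.
- move=> x /=; have [/codomP[y ->]|xN] := boolP (x \in codom (mF f)).
    by rewrite glue_in !mV_bd mI_bd.
  by rewrite glue_out // mI_bd.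
Defined.

(* The morphism without edges given by bijections on vertices and flags. *)
Definition relabel (X Y : aggregate) (v : vert X -> vert Y)
    (v' : vert Y -> vert X) (h : flag Y -> flag X) (h' : flag X -> flag Y)
    (vK : cancel v' v) (hK : cancel h h') (hK' : cancel h' h)
    (e : forall y, v (bd (h y)) = bd y) : agg_mor X Y.
Proof.
refine (@AggMor X Y v h id _ _ _ _ _ _) => //.
- by move=> w; exists (v' w).
- exact: can_inj hK.
- by move=> x; rewrite eqxx -(hK' x) codom_f.
Defined.

Definition agg_id (X : aggregate) : agg_mor X X :=
  @relabel X X id id id id (fun _ => erefl) (fun _ => erefl) (fun _ => erefl)
    (fun _ => erefl).

Lemma glue_edgeless (X Y Z : aggregate) (g : agg_mor Y Z) (f : agg_mor X Y) x :
  mI g =1 id -> glue g f x = mI f x.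
Proof.
move=> gid; have [/codomP[y ->]|xN] := boolP (x \in codom (mF f)).
  by rewrite glue_in gid mI_mF.
exact: glue_out.
Qed.

Definition agg_cat : category.
Proof.
refine (@Category aggregate agg_mor agg_heq agg_id agg_comp agg_equiv _ _ _ _).
- move=> X Y Z g g' f f' [g1 g2 g3] [f1 f2 f3]; split=> x /=.
  + by rewrite f1 g1.
  + by rewrite g2 f2.
  + have [/codomP[y ->]|xN] := boolP (x \in codom (mF f)).
      by rewrite glue_in [in RHS]f2 glue_in -f2 g3.
    by rewrite !glue_out // -(eq_codom f2).
- move=> W X Y Z h g f; split=> x //=.
  have [/codomP[y ->]|xN] := boolP (x \in codom (mF f)).
    rewrite glue_in /=; have [/codomP[z ->]|yN] := boolP (y \in codom (mF g)).
      by rewrite glue_in -[mF f (mF g z)]/(mF (agg_comp g f) z) glue_in.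
    rewrite (glue_out h yN) (@glue_out _ _ _ h (agg_comp g f)) /= ?glue_in //.
    apply: contra yN => /codomP[z /= /mF_inj ->]; exact: codom_f.
  rewrite (glue_out _ xN) (@glue_out _ _ _ h (agg_comp g f)) /= ?glue_out //.
  apply: contra xN => /codomP[z ->]; exact: codom_f.
- by move=> X Y f; split=> x //=; rewrite glue_edgeless.
- by move=> X Y f; split=> x //=; exact: (@glue_in _ _ _ f (agg_id X) x).
Defined.

Definition relabel_iso (X Y : agg_cat) (v : vert X -> vert Y)
    (v' : vert Y -> vert X) (h : flag Y -> flag X) (h' : flag X -> flag Y)
    (vK : cancel v v') (vK' : cancel v' v) (hK : cancel h h')
    (hK' : cancel h' h) (e : forall y, v (bd (h y)) = bd y)
    (e' : forall x, v' (bd (h' x)) = bd x) : iso X Y.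
Proof.
refine (@Iso agg_cat X Y (relabel vK' hK hK' e) (relabel vK hK' hK e') _ _).
- by split=> x //=; rewrite glue_edgeless.
- by split=> x //=; rewrite glue_edgeless.
Defined.

Definition sum_map (A B A' B' : Type) (f : A -> A') (g : B -> B')
    (x : A + B) : A' + B' :=
  match x with inl a => inl (f a) | inr b => inr (g b) end.

Definition agg_tens (X Y : aggregate) : aggregate :=
  @Aggregate (vert X + vert Y)%type (flag X + flag Y)%type (sum_map bd bd).

Definition agg_unit : aggregate := @Aggregate void void (fun x => x).

Lemma codom_sum_l (A B A' B' : finType) (f : A -> A') (g : B -> B') x :
  (inl x \in codom (sum_map f g)) = (x \in codom f).
Proof.
apply/codomP/codomP => [[[a|b] //= [->]]|[a ->]]; first by exists a.
by exists (inl a).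
Qed.

Lemma codom_sum_r (A B A' B' : finType) (f : A -> A') (g : B -> B') x :
  (inr x \in codom (sum_map f g)) = (x \in codom g).
Proof.
apply/codomP/codomP => [[[a|b] //= [->]]|[b ->]]; first by exists b.
by exists (inr b).
Qed.

Definition agg_tensm (X Y X' Y' : aggregate) (f : agg_mor X X')
    (g : agg_mor Y Y') : agg_mor (agg_tens X Y) (agg_tens X' Y').
Proof.
refine (@AggMor (agg_tens X Y) (agg_tens X' Y') (sum_map (mV f) (mV g))
  (sum_map (mF f) (mF g)) (sum_map (mI f) (mI g)) _ _ _ _ _ _).
- move=> [w|w]; first by have [v <-] := mV_surj f w; exists (inl v).
  by have [v <-] := mV_surj g w; exists (inr v).
- by move=> [x|x] [y|y] //= [] /mF_inj ->.
- by move=> [x|x] /=; rewrite mI_invol.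
- move=> [x|x]; rewrite ?codom_sum_l ?codom_sum_r -mI_fix;
    by apply/eqP/eqP => [[->]|/= ->].
- by move=> [y|y] /=; rewrite mV_bd.
- by move=> [x|x] /=; rewrite mI_bd.
Defined.

Lemma comp_edgeless (X Y Z : aggregate) (g : agg_mor Y Z) (f : agg_mor X Y) :
  mI g =1 id -> mI f =1 id -> mI (agg_comp g f) =1 id.
Proof. by move=> eg ef x; rewrite /= glue_edgeless. Qed.

Lemma tens_edgeless (X Y X' Y' : aggregate) (f : agg_mor X X')
    (g : agg_mor Y Y') :
  mI f =1 id -> mI g =1 id -> mI (agg_tensm f g) =1 id.
Proof. by move=> ef eg [x|x] /=; rewrite ?ef ?eg. Qed.

Lemma edgeless_eq (X Y : aggregate) (f g : agg_mor X Y) :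
  mI f =1 id -> mI g =1 id -> mI f =1 mI g.
Proof. by move=> ef eg x; rewrite ef eg. Qed.

Ltac edgeless :=
  repeat first [apply: comp_edgeless | apply: tens_edgeless | done].

Definition sum_assoc (A B C : Type) (x : A + B + C) : A + (B + C) :=
  match x with
  | inl (inl a) => inl a | inl (inr b) => inr (inl b) | inr c => inr (inr c)
  end.

Definition sum_assoc' (A B C : Type) (x : A + (B + C)) : A + B + C :=
  match x with
  | inl a => inl (inl a) | inr (inl b) => inl (inr b) | inr (inr c) => inr c
  end.

Definition sum_swap (A B : Type) (x : A + B) : B + A :=
  match x with inl a => inr a | inr b => inl b end.

Definition sum_lunit (A : Type) (x : void + A) : A :=
  match x with inl e => match e with end | inr a => a end.

Definition sum_runit (A : Type) (x : A + void) : A :=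
  match x with inl a => a | inr e => match e with end end.

Definition agg_assoc (X Y Z : agg_cat) :
  @iso agg_cat (agg_tens (agg_tens X Y) Z) (agg_tens X (agg_tens Y Z)).
Proof.
by apply: (@relabel_iso (agg_tens (agg_tens X Y) Z) (agg_tens X (agg_tens Y Z))
  (@sum_assoc _ _ _) (@sum_assoc' _ _ _) (@sum_assoc' _ _ _)
  (@sum_assoc _ _ _)); do ?[case=> //].
Defined.

Definition agg_lunit (X : agg_cat) : @iso agg_cat (agg_tens agg_unit X) X.
Proof.
by apply: (@relabel_iso (agg_tens agg_unit X) X (@sum_lunit _) inr inr
  (@sum_lunit _)); do ?[case=> //].
Defined.

Definition agg_runit (X : agg_cat) : @iso agg_cat (agg_tens X agg_unit) X.
Proof.
by apply: (@relabel_iso (agg_tens X agg_unit) X (@sum_runit _) inl inl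
  (@sum_runit _)); do ?[case=> //].
Defined.

Definition agg_braid (X Y : agg_cat) :
  @iso agg_cat (agg_tens X Y) (agg_tens Y X).
Proof.
by apply: (@relabel_iso (agg_tens X Y) (agg_tens Y X) (@sum_swap _ _)
  (@sum_swap _ _) (@sum_swap _ _) (@sum_swap _ _)); do ?[case=> //].
Defined.

(* Aggregates under disjoint union. *)
Definition Agg : smcat.
Proof.
refine (@SMCat agg_cat agg_tens agg_unit agg_tensm agg_assoc agg_lunit
  agg_runit (fun X Y => fwd (agg_braid X Y)) _ _ _ _ _ _ _ _ _ _ _).
- move=> A B A' B' f f' g g' [f1 f2 f3] [g1 g2 g3].
  by split=> -[x|x] /=; rewrite ?f1 ?f2 ?f3 ?g1 ?g2 ?g3.
- by move=> A B; split=> -[x|x].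
- move=> A B A' B' A'' B'' f' g' f g; split=> -[x|x] //=.
    have [/codomP[y ->]|xN] := boolP (x \in codom (mF f)).
      by rewrite glue_in (@glue_in _ _ _ _ (agg_tensm f g) (inl y)).
    by rewrite !glue_out // codom_sum_l.
  have [/codomP[y ->]|xN] := boolP (x \in codom (mF g)).
    by rewrite glue_in (@glue_in _ _ _ _ (agg_tensm f g) (inr y)).
  by rewrite !glue_out // codom_sum_r.
- move=> A B C A' B' C' f g h; split=> x; [by case: x => [[x|x]|x]| |].
    by case: x => [x|[x|x]].
  have E := @glue_in _ _ _ (agg_tensm f (agg_tensm g h)) (fwd (agg_assoc A B C)).
  rewrite /= glue_edgeless //; case: x => [[x|x]|x]; symmetry.
  + exact: (E (inl x)).
  + exact: (E (inr (inl x))).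
  + exact: (E (inr (inr x))).
- move=> A A' f; split=> x; [by case: x => [[]|x]|by []|].
  rewrite /= glue_edgeless //; case: x => [[]|x]; symmetry.
  exact: (@glue_in _ _ _ f (fwd (agg_lunit A)) x).
- move=> A A' f; split=> x; [by case: x => [x|[]]|by []|].
  rewrite /= glue_edgeless //; case: x => [x|[]]; symmetry.
  exact: (@glue_in _ _ _ f (fwd (agg_runit A)) x).
- move=> A B A' B' f g; split=> x; [by case: x|by case: x|].
  have E := @glue_in _ _ _ (agg_tensm g f) (fwd (agg_braid A B)).
  rewrite /= glue_edgeless //; case: x => x; symmetry.
  + exact: (E (inr x)).
  + exact: (E (inl x)).
- move=> A B; split; [by case=> [[x|[]]|x]|by case|].
  by apply: edgeless_eq; edgeless.
- move=> A B C D; split; [by case=> [[[]|]|]|by case=> [|[|[]]]|].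
  by apply: edgeless_eq; edgeless.
- move=> A B C; split; [by case=> [[]|]|by case=> [|[]]|].
  by apply: edgeless_eq; edgeless.
- move=> A B; split; [by case|by case|].
  by apply: edgeless_eq; edgeless.
Defined.

(** * Ghost graphs and trees *)

(* The edges are the two-element orbits of [gr_inv]; the fixed flags are the
   tails. *)
Record graph := Graph {
  gr_agg :> aggregate;
  gr_inv : flag gr_agg -> flag gr_agg
}.

Arguments gr_inv {g} _.

Definition edge_flag (G : graph) (x : flag G) : bool := gr_inv x != x.

Definition adjacent (G : graph) : rel (vert G) :=
  fun v w => [exists x : flag G,
    [&& edge_flag x, bd x == v & bd (gr_inv x) == w]].

Definition is_connected (G : graph) : Prop :=
  0 < #|vert G| /\ forall v w : vert G, connect (@adjacent G) v w.

(* A closed walk, given by the flags at which its successive edges are entered,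
   without repeated edges; loops give circuits of length one. *)
Definition is_circuit (G : graph) (s : seq (flag G)) : bool :=
  [&& s != [::], all (@edge_flag G) s,
      cycle (fun x y => bd (gr_inv x) == bd y) s,
      uniq s & all (fun x => gr_inv x \notin s) s].

Definition is_tree (G : graph) : Prop :=
  is_connected G /\ forall s : seq (flag G), ~~ is_circuit s.

Definition ghost (X Y : aggregate) (f : agg_mor X Y) : graph := Graph (mI f).

Definition is_corolla (X : aggregate) : Prop := #|vert X| = 1.

Definition basic_tree (X Y : Agg) (f : hom X Y) : Prop :=
  is_corolla Y /\ is_tree (ghost f).

(** * The Feynman category for cyclic operads *)

Definition AggCyc : smcat := generated_smc basic_tree.

Definition Corollas : category := @groupoid_on AggCyc is_corolla.

Definition Fcyc : feynman_data :=
  @FeynmanData Corollas (@groupoid_on_inv AggCyc is_corolla) AggCyc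
    (@groupoid_incl AggCyc is_corolla).

(* Main.v *)
From Stdlib Require Import Setoid Morphisms.
From mathcomp Require Import all_boot zify.
Require Import Defs.

Set Implicit Arguments.
Unset Strict Implicit.
Unset Printing Implicit Defensive.

Local Open Scope cat_scope.

(** Composition in a category has a direction, gluing half edges does not: among
    three half edges any two can be joined, and then nothing is left for the
    third.  Associativity of γ turns this into a contradiction.

    Let F : M^+ -> F^cyc be an equivalence and measure a morphism of M by the
    numbers of vertices and flags of its image.  Joining two half edges into a
    point must come from M^+, whose morphisms are words in isomorphisms of arrows
    and γ's.  So some γ_{a,b} joins them ([half_edge_pair]): a and b are
    composable, each has a half edge as its image, and a ∘ b has a point.

    Suppose there were also a morphism c such that the image of b ∘ c has no
    flags.  By associativity, the maps from a ⊗ b ⊗ c to a ∘ b ∘ c through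
    (a ∘ b) ⊗ c and through a ⊗ (b ∘ c) agree.  The first one identifies the
    vertices of a and b.  Hence γ_{a,b∘c} merges the vertex of a with one of
    b ∘ c; but in F^cyc vertices are merged only along edges
    ([merged_vertex_edge]), and b ∘ c has no flags to form an edge.

    It remains to find c.  As a and b have isomorphic images, M^+ has a morphism
    from a to b.  A γ_{g,f} for which F g is empty is harmless: g is then
    invertible for ⊗ ([num_vert_eq0]), therefore an isomorphism of M
    ([invertible_arr_iso]), and g ∘ f ≅ f.  It follows that morphisms of M^+
    between objects with one vertex only introduce ⊗-invertible factors
    ([plus_hom_associated]), so b ≅ a ⊗ id_P with P invertible, and one can take
    for c the morphism b ⊗ id_P, up to an isomorphism of its target
    ([associated_step]): then b ∘ c ≅ (a ∘ b) ⊗ id_P. *)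

(** * Tensor-invertible objects *)

Definition isomorphic (C : category) (X Y : C) : Prop := inhabited (iso X Y).

Notation "X ≃ Y" := (isomorphic X Y)
  (at level 70, no associativity) : cat_scope.

#[global] Instance isomorphic_equiv (C : category) :
  Equivalence (@isomorphic C).
Proof.
split.
- by move=> X; constructor; exact: iso_id.
- by move=> X Y [s]; constructor; exact: iso_inv.
- by move=> X Y Z [s] [t]; constructor; exact: iso_comp t s.
Qed.

#[global] Hint Extern 0 (isomorphic _ _) => reflexivity : core.

#[global] Instance tens_isomorphic (C : smcat) :
  Proper (@isomorphic C ==> @isomorphic C ==> @isomorphic C) (@tens C).
Proof. by move=> A A' [s] B B' [t]; constructor; exact: iso_tens. Qed.

Lemma tens_assoc (C : smcat) (A B D : C) : (A ⊗ B) ⊗ D ≃ A ⊗ (B ⊗ D).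
Proof. by constructor; exact: assoc. Qed.

Lemma tens_comm (C : smcat) (A B : C) : A ⊗ B ≃ B ⊗ A.
Proof. by constructor; exact: iso_braid. Qed.

Lemma tens_unit (C : smcat) (A : C) : A ⊗ 𝟙 ≃ A.
Proof. by constructor; exact: runit. Qed.

Definition invertible (C : smcat) (X : C) : Prop := exists Y : C, X ⊗ Y ≃ 𝟙.

#[global] Instance invertible_isomorphic (C : smcat) :
  Proper (@isomorphic C ==> iff) (@invertible C).
Proof. by move=> X Y e; split=> -[Z eZ]; exists Z; rewrite -eZ e. Qed.

Lemma invertible_unit (C : smcat) : invertible (𝟙 : C).
Proof. by exists 𝟙; exact: tens_unit. Qed.

Lemma invertible_tens (C : smcat) (X Y : C) :
  invertible (X ⊗ Y) <-> invertible X /\ invertible Y.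
Proof.
split=> [[Z e]|[[X' eX] [Y' eY]]].
  split; first by exists (Y ⊗ Z); rewrite -tens_assoc.
  by exists (X ⊗ Z); rewrite -tens_assoc (tens_comm Y).
exists (Y' ⊗ X').
by rewrite tens_assoc -(tens_assoc Y) eY (tens_comm 𝟙) tens_unit.
Qed.

(** As in ring theory: equality up to an invertible factor. *)
Definition associated (C : smcat) (X Y : C) : Prop :=
  exists2 U : C, invertible U & Y ≃ X ⊗ U.

Lemma associated_tens_invertible (C : smcat) (X U : C) :
  invertible U -> associated X (X ⊗ U).
Proof. by exists U. Qed.

Lemma associated_invertible_tens (C : smcat) (X U : C) :
  invertible U -> associated X (U ⊗ X).
Proof. by exists U => //; exact: tens_comm. Qed.

#[global] Instance associated_equiv (C : smcat) : Equivalence (@associated C).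
Proof.
split.
- move=> X; exists 𝟙; first exact: invertible_unit.
  by symmetry; exact: tens_unit.
- move=> X Y [U [V eUV] e]; exists V.
    by exists U; rewrite tens_comm.
  by rewrite e tens_assoc eUV tens_unit.
- move=> X Y Z [U iU eU] [V iV eV]; exists (U ⊗ V).
    exact/invertible_tens.
  by rewrite -tens_assoc -eU.
Qed.

#[global] Instance associated_isomorphic (C : smcat) :
  Proper (@isomorphic C ==> @isomorphic C ==> iff) (@associated C).
Proof.
by move=> X X' e Y Y' e'; split=> -[U iU eU]; exists U => //;
  [rewrite -e -e' | rewrite e e'].
Qed.

(** * Invertible objects of the groupoid of morphisms *)

Lemma arr_isomorphic (M : smcat) (φ ψ : arr_smc M) : arr_iso φ ψ -> φ ≃ ψ.
Proof. by move=> s; constructor; exact: arr_to_iso. Qed.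

Lemma isomorphic_src (M : smcat) (φ ψ : arr_smc M) : φ ≃ ψ -> src φ ≃ src ψ.
Proof. by move=> [s]; constructor; exact: iso_src (fwd s). Qed.

Lemma isomorphic_tgt (M : smcat) (φ ψ : arr_smc M) : φ ≃ ψ -> tgt φ ≃ tgt ψ.
Proof. by move=> [s]; constructor; exact: iso_tgt (fwd s). Qed.

Definition split_mono (C : category) (X Y : C) (f : hom X Y) : Prop :=
  exists r : hom Y X, r ∘ f ≈ idm X.

Definition split_epi (C : category) (X Y : C) (f : hom X Y) : Prop :=
  exists r : hom Y X, f ∘ r ≈ idm Y.

Lemma split_mono_epi (C : category) (X Y : C) (f : hom X Y) :
  split_mono f -> split_epi f -> exists s : iso X Y, fwd s ≈ f.
Proof.
move=> [r er] [l el].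
have e : r ≈ l by rewrite -(compm1 r) -el compA er comp1m.
have el' : l ∘ f ≈ idm X by rewrite -e.
by exists (Iso el' el).
Qed.

#[global] Instance split_mono_heq (C : category) (X Y : C) :
  Proper (heq ==> iff) (@split_mono C X Y).
Proof. by move=> f g e; split=> -[r er]; exists r; rewrite -er e. Qed.

#[global] Instance split_epi_heq (C : category) (X Y : C) :
  Proper (heq ==> iff) (@split_epi C X Y).
Proof. by move=> f g e; split=> -[r er]; exists r; rewrite -er e. Qed.

Lemma split_mono_compr (C : category) (X Y Z : C) (g : hom Y Z) (f : hom X Y) :
  split_mono (g ∘ f) -> split_mono f.
Proof. by move=> [r er]; exists (r ∘ g); rewrite -compA. Qed.

Lemma split_epi_compl (C : category) (X Y Z : C) (g : hom Y Z) (f : hom X Y) :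
  split_epi (g ∘ f) -> split_epi g.
Proof. by move=> [r er]; exists (f ∘ r); rewrite compA. Qed.

Lemma split_mono_arr_iso (M : smcat) (φ ψ : arr_smc M) :
  φ ≃ ψ -> split_mono (arrow φ) -> split_mono (arrow ψ).
Proof.
move=> [[[s s' sq] _ _ _]] [r er]; exists (s ∘ r ∘ bwd s').
rewrite -(compm1 (arrow ψ)) -(fwdK s) (compA (arrow ψ)) sq.
by rewrite -!compA (compA (bwd s')) bwdK comp1m (compA r) er comp1m.
Qed.

Lemma split_epi_arr_iso (M : smcat) (φ ψ : arr_smc M) :
  φ ≃ ψ -> split_epi (arrow φ) -> split_epi (arrow ψ).
Proof.
move=> [[[s s' sq] _ _ _]] [r er]; exists (s ∘ r ∘ bwd s').
rewrite !compA sq -!compA (compA (arrow φ)) er comp1m.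
exact: fwdK.
Qed.

Lemma tens_id_arr (M : smcat) (X Y : M) :
  (Arr (idm X) : arr_smc M) ⊗ Arr (idm Y) ≃ Arr (idm (X ⊗ Y)).
Proof. by apply: arr_isomorphic; exact: arr_cast (tensm_id X Y). Qed.

Lemma isomorphic_id_arr (M : smcat) (X Y : M) :
  X ≃ Y -> (Arr (idm X) : arr_smc M) ≃ Arr (idm Y).
Proof.
move=> [s]; apply: arr_isomorphic.
by apply: (@ArrIso M (Arr (idm X)) (Arr (idm Y)) s s); rewrite comp1m compm1.
Qed.

Lemma untensor_invertible (M : smcat) (φ : arr_smc M) (U V : M) :
  U ⊗ V ≃ 𝟙 -> φ ⊗ Arr (idm U) ⊗ Arr (idm V) ≃ φ.
Proof.
move=> e; rewrite tens_assoc tens_id_arr (isomorphic_id_arr e).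
exact: tens_unit.
Qed.

Lemma split_mono_untensor (M : smcat) (X Y U : M) (f : hom X Y) :
  invertible U -> split_mono (f ⊠ idm U) -> split_mono f.
Proof.
move=> [V e] [r er].
apply: (split_mono_arr_iso (untensor_invertible (Arr f : arr_smc M) e)).
by exists (r ⊠ idm V); rewrite /= -tensm_comp er comp1m tensm_id.
Qed.

Lemma split_epi_untensor (M : smcat) (X Y U : M) (f : hom X Y) :
  invertible U -> split_epi (f ⊠ idm U) -> split_epi f.
Proof.
move=> [V e] [r er].
apply: (split_epi_arr_iso (untensor_invertible (Arr f : arr_smc M) e)).
by exists (r ⊠ idm V); rewrite /= -tensm_comp er comp1m tensm_id.
Qed.

Lemma invertible_src (M : smcat) (φ : arr_smc M) :
  invertible φ -> invertible (src φ).
Proof. by move=> [ψ /isomorphic_src e]; exists (src ψ). Qed.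

(** Let f ⊗ g be isomorphic to the identity of the unit object.  The
    factorizations f ⊗ g = (id ⊗ g) ∘ (f ⊗ id) = (f ⊗ id) ∘ (id ⊗ g) make f,
    tensored with the source, respectively the target, of g, split mono,
    respectively split epi; both objects are invertible and can be cancelled. *)
Lemma invertible_arr_iso (M : smcat) (X Y : M) (f : hom X Y) :
  invertible (Arr f : arr_smc M) -> exists s : iso X Y, fwd s ≈ f.
Proof.
move=> [[X' Y' g] e]; have e' : 𝟙 ≃ (Arr f : arr_smc M) ⊗ Arr g by symmetry.
have iX' : invertible X'.
  by exists X; rewrite tens_comm; exact: isomorphic_src e.
have iY' : invertible Y'.
  by exists Y; rewrite tens_comm; exact: isomorphic_tgt e.
apply: split_mono_epi.
  apply: (split_mono_untensor iX').
  apply: (@split_mono_compr _ _ _ _ (idm Y ⊠ g)).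
  rewrite -tensm_comp comp1m compm1; apply: (split_mono_arr_iso e').
  by exists (idm _); exact: comp1m.
apply: (split_epi_untensor iY').
apply: (@split_epi_compl _ _ _ _ _ (idm X ⊠ g)).
rewrite -tensm_comp comp1m compm1; apply: (split_epi_arr_iso e').
by exists (idm _); exact: comp1m.
Qed.

Lemma invertible_id_arr (M : smcat) (X : M) :
  invertible X -> invertible (Arr (idm X) : arr_smc M).
Proof.
move=> [Y e]; exists (Arr (idm Y)).
by rewrite tens_id_arr; exact: isomorphic_id_arr.
Qed.

Lemma comp_invertible_l (M : smcat) (X Y Z : M) (g : hom Y Z) (f : hom X Y) :
  invertible (Arr g : arr_smc M) -> (Arr (g ∘ f) : arr_smc M) ≃ Arr f.
Proof.
move=> /invertible_arr_iso[s es]; symmetry; apply: arr_isomorphic.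
by apply: (@ArrIso M (Arr f) (Arr (g ∘ f)) (iso_id X) s); rewrite /= es compm1.
Qed.

Lemma comp_invertible_r (M : smcat) (X Y Z : M) (g : hom Y Z) (f : hom X Y) :
  invertible (Arr f : arr_smc M) -> (Arr (g ∘ f) : arr_smc M) ≃ Arr g.
Proof.
move=> /invertible_arr_iso[s es]; apply: arr_isomorphic.
by apply: (@ArrIso M (Arr (g ∘ f)) (Arr g) s (iso_id Z)); rewrite /= es comp1m.
Qed.

(** Composing f with the identity of its source, and cancelling f instead. *)
Lemma invertible_arr_id (M : smcat) (φ : arr_smc M) :
  invertible φ -> exists2 P : M, invertible P & φ ≃ Arr (idm P).
Proof.
case: φ => X Y f iφ; exists X; first exact: invertible_src iφ.
rewrite -(comp_invertible_l (idm X) iφ).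
by apply: arr_isomorphic; apply: arr_cast; symmetry; exact: compm1.
Qed.

(** If b is isomorphic to a ⊗ id_P, then the target of b ⊗ id_P is isomorphic
    to the source of b, and composing along this isomorphism gives
    b ∘ (b ⊗ id_P) ≅ (a ⊗ id_P) ∘ (b ⊗ id_P).  This prolongs a composable pair of
    associated morphisms to a composable triple, although neither of them need
    be an endomorphism. *)
Lemma associated_step (M : smcat) (X Y Z : M) (a : hom Y Z) (b : hom X Y) :
  associated (Arr a : arr_smc M) (Arr b) ->
  exists (W : M) (c : hom W X),
    associated (Arr (a ∘ b) : arr_smc M) (Arr (b ∘ c)).
Proof.
move=> [κ /invertible_arr_id[P iP eκ]].
rewrite eκ => e.
have [[[/= t s sq] _ _ _]] : (Arr a : arr_smc M) ⊗ Arr (idm P) ≃ Arr b.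
  by symmetry.
exists (X ⊗ P), (t ∘ (b ⊠ idm P)); exists (Arr (idm P)).
  exact: invertible_id_arr.
symmetry; apply: arr_isomorphic.
apply: (@ArrIso M (arr_tens (Arr (a ∘ b)) (Arr (idm P)))
  (Arr (b ∘ (t ∘ (b ⊠ idm P)))) (iso_id _) s).
rewrite /= compm1 compA sq -compA -tensm_comp comp1m.
reflexivity.
Qed.

(** * Vertices, flags and edges of aggregates *)

Lemma mV_iso_inj (X Y : Agg) (s : iso X Y) : injective (mV (fwd s)).
Proof. by case: (bwdK s) => eV _ _; exact: (@can_inj _ _ _ (mV (bwd s)) eV). Qed.

Lemma mF_neq_codom (X Y : aggregate) (f : agg_mor X Y) x :
  (mI f x != x) = (x \notin codom (mF f)).
Proof. by rewrite mI_fix. Qed.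

(** In a tree with at least two vertices each one lies on an edge.  For a composite
    g ∘ f, an edge of g at the image of v lifts to a flag that may sit
    at another vertex in the fibre of f; then f itself has merged v with that
    vertex, and provides an edge at v. *)
Lemma merged_vertex_edge (X Y : Agg) (f : hom X Y) :
  generated basic_tree f -> forall v w : vert X, v != w -> mV f v = mV f w ->
  exists2 x : flag X, bd x = v & mI f x != x.
Proof.
elim=> {X Y f} [X Y s|X Y f [_ [[_ conn] _]]|X Y Z g f _ IHg _ IHf|
    X Y X' Y' f g _ IHf _ IHg|X Y f g [eV _ eI] _ IHf] v w nvw e.
- by move: nvw; rewrite (mV_iso_inj e) eqxx.
- case/connectP: (conn v w) nvw => -[|u p] /=; first by move=> _ ->; rewrite eqxx.
  case/andP=> /existsP[x /and3P[ex /eqP bx _]] _ _ _.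
  by exists x.
- have edge_of_f x : bd x = v -> mI f x != x ->
      exists2 x0, bd x0 = v & mI (agg_comp g f) x0 != x0.
    by move=> bx ex; exists x => //=; rewrite glue_out -?mF_neq_codom.
  have [efvw|nfvw] := eqVneq (mV f v) (mV f w).
    by have [x] := IHf v w nvw efvw; exact: edge_of_f.
  have [y by_ ey] := IHg _ _ nfvw e.
  have [bv|nbv] := eqVneq (bd (mF f y)) v.
    by exists (mF f y) => //=; rewrite glue_in (inj_eq (@mF_inj _ _ f)).
  rewrite eq_sym in nbv.
  have [|x] := IHf v (bd (mF f y)) nbv; last exact: edge_of_f.
  by rewrite mV_bd.
- case: v w nvw e => [v|v] [w|w] //= nvw [].
    by case/(IHf v w nvw) => x <- ex; exists (inl x).
  by case/(IHg v w nvw) => x <- ex; exists (inr x).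
- have [|x bx ex] := IHf v w nvw; first by rewrite !eV.
  by exists x; rewrite -?eI.
Qed.

Lemma card_vert_hom (X Y : aggregate) (f : agg_mor X Y) : #|vert Y| <= #|vert X|.
Proof.
have /fin_all_exists[h hK] := mV_surj f.
exact: leq_card h (can_inj hK).
Qed.

Lemma card_flag_hom (X Y : aggregate) (f : agg_mor X Y) : #|flag Y| <= #|flag X|.
Proof. exact: leq_card (mF f) (@mF_inj _ _ f). Qed.

Lemma card_vert_isomorphic (X Y : AggCyc) : X ≃ Y -> #|vert X| = #|vert Y|.
Proof.
move=> [s]; apply/eqP; rewrite eqn_leq.
by rewrite (card_vert_hom (sval (fwd s))) (card_vert_hom (sval (bwd s))).
Qed.

Lemma card_flag_isomorphic (X Y : AggCyc) : X ≃ Y -> #|flag X| = #|flag Y|.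
Proof.
move=> [s]; apply/eqP; rewrite eqn_leq.
by rewrite (card_flag_hom (sval (fwd s))) (card_flag_hom (sval (bwd s))).
Qed.

Lemma card_can (A B : finType) : #|A| = #|B| ->
  exists (f : A -> B) (g : B -> A), cancel f g /\ cancel g f.
Proof.
move=> e; exists (fun a => enum_val (cast_ord e (enum_rank a))),
  (fun b => enum_val (cast_ord (esym e) (enum_rank b))).
by split=> x; rewrite enum_valK ?cast_ordK ?cast_ordKV enum_rankK.
Qed.

(** With at most one vertex there is no incidence to respect. *)
Lemma corolla_isomorphic (X Y : AggCyc) :
  #|vert X| = #|vert Y| -> #|flag X| = #|flag Y| -> #|vert Y| <= 1 -> X ≃ Y.
Proof.
move=> eV eF leY; have [v [v' [vK vK']]] := card_can eV.
have [h' [h [hK' hK]]] := card_can eF.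
have leX : #|vert X| <= 1 by rewrite eV.
constructor; apply: (@sub_iso Agg basic_tree).
apply: (@relabel_iso X Y v v' h h') => // x.
  exact: (fintype_le1P leY).
exact: (fintype_le1P leX).
Qed.

(** Two half edges are joined to an isolated point by contracting one edge. *)
Definition half_edge : AggCyc := @Aggregate unit unit id.

Definition point : AggCyc := @Aggregate unit void (fun _ => tt).

Definition join_half_edges_mor : agg_mor (half_edge ⊗ half_edge) point.
Proof.
refine (@AggMor (agg_tens half_edge half_edge) point (fun _ => tt) (of_void _)
  (@sum_swap _ _) _ _ _ _ _ _) => //; first by case; exists (inl tt).
  by case.
by move=> [[]|[]]; symmetry; apply/negbTE/codomP => -[].
Defined.

Lemma join_half_edges_tree : is_tree (ghost join_half_edges_mor).
Proof.
split.
  split=> [|v w]; first by apply/card_gt0P; exists (inl tt).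
  case: v w => [[]|[]] [[]|[]]; rewrite ?connect0 //; apply: connect1;
    apply/existsP; [by exists (inl tt)|by exists (inr tt)].
case=> [|x [|y s]] //; first by case: x => [[]|[]].
by case: x y => [[]|[]] [[]|[]]; rewrite /is_circuit /= ?inE /= ?andbF.
Qed.

Definition join_half_edges : hom (half_edge ⊗ half_edge) point.
Proof.
exists (join_half_edges_mor : @hom Agg (agg_tens half_edge half_edge) point).
by apply: gen_base; split; [exact: card_unit | exact: join_half_edges_tree].
Defined.

(** * Vertices and flags of morphisms of the plus construction *)

Lemma plus_isomorphic (M : smcat) (φ ψ : arr_smc M) :
  φ ≃ ψ -> isomorphic (φ : plus M) ψ.
Proof. by move=> [s]; constructor; exact: plus_of_iso (fwd s). Qed.

(** The case that matters is γ_{g,f}: if g ⊗ f is invertible then so are g and f,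
    and composing with the isomorphism g does not change f. *)
Lemma plus_hom_invertible (M : smcat) (φ ψ : arr_smc M) :
  plus_hom φ ψ -> invertible φ -> invertible ψ.
Proof.
elim=> {φ ψ} [φ ψ /arr_isomorphic e|X Y Z g f|φ ψ χ _ IHb _ IHa|
    φ ψ φ' ψ' _ IHa _ IHb].
- by rewrite e.
- case/(invertible_tens (Arr g : arr_smc M)) => ig ?.
  by rewrite comp_invertible_l.
- by move=> /IHa/IHb.
- case/(invertible_tens (φ : arr_smc M)) => ? ?.
  by apply/(invertible_tens (φ' : arr_smc M)); split; auto.
Qed.

Definition num_vert (M : smcat) (F : smfunctor (plus M) AggCyc)
    (φ : arr_smc M) : nat :=
  #|vert (F φ)|.

Definition num_flag (M : smcat) (F : smfunctor (plus M) AggCyc)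
    (φ : arr_smc M) : nat :=
  #|flag (F φ)|.

Lemma fmap_isomorphic (C D : category) (F : functor C D) (X Y : C) :
  X ≃ Y -> F X ≃ F Y.
Proof.
move=> [s]; constructor; apply: (@Iso D (F X) (F Y) (fmap F s) (fmap F (bwd s))).
  by rewrite -fmap_comp (fmap_heq F (bwdK s)) fmap_id.
by rewrite -fmap_comp (fmap_heq F (fwdK s)) fmap_id.
Qed.

Lemma num_vert_isomorphic (M : smcat) (F : smfunctor (plus M) AggCyc)
    (φ ψ : arr_smc M) :
  φ ≃ ψ -> num_vert F φ = num_vert F ψ.
Proof.
move=> /plus_isomorphic /(fmap_isomorphic F) e.
exact: (card_vert_isomorphic e).
Qed.

Lemma num_flag_isomorphic (M : smcat) (F : smfunctor (plus M) AggCyc)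
    (φ ψ : arr_smc M) :
  φ ≃ ψ -> num_flag F φ = num_flag F ψ.
Proof.
move=> /plus_isomorphic /(fmap_isomorphic F) e.
exact: (card_flag_isomorphic e).
Qed.

Lemma num_vert_tens (M : smcat) (F : smfunctor (plus M) AggCyc)
    (φ ψ : arr_smc M) :
  num_vert F (φ ⊗ ψ) = num_vert F φ + num_vert F ψ.
Proof.
rewrite /num_vert -card_sum; symmetry.
exact: (card_vert_isomorphic (inhabits (smf_tens F φ ψ))).
Qed.

Lemma num_flag_tens (M : smcat) (F : smfunctor (plus M) AggCyc)
    (φ ψ : arr_smc M) :
  num_flag F (φ ⊗ ψ) = num_flag F φ + num_flag F ψ.
Proof.
rewrite /num_flag -card_sum; symmetry.
exact: (card_flag_isomorphic (inhabits (smf_tens F φ ψ))).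
Qed.

Lemma num_vert_unit (M : smcat) (F : smfunctor (plus M) AggCyc) :
  num_vert F (𝟙 : arr_smc M) = 0.
Proof.
rewrite -card_void; symmetry.
exact: (card_vert_isomorphic (inhabits (smf_unit F))).
Qed.

Lemma num_flag_unit (M : smcat) (F : smfunctor (plus M) AggCyc) :
  num_flag F (𝟙 : arr_smc M) = 0.
Proof.
rewrite -card_void; symmetry.
exact: (card_flag_isomorphic (inhabits (smf_unit F))).
Qed.

Lemma num_vert_invertible (M : smcat) (F : smfunctor (plus M) AggCyc)
    (φ : arr_smc M) :
  invertible φ -> num_vert F φ = 0.
Proof.
move=> [ψ /(num_vert_isomorphic F)/eqP].
by rewrite num_vert_tens num_vert_unit addn_eq0 => /andP[/eqP].
Qed.

Lemma num_flag_invertible (M : smcat) (F : smfunctor (plus M) AggCyc)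
    (φ : arr_smc M) :
  invertible φ -> num_flag F φ = 0.
Proof.
move=> [ψ /(num_flag_isomorphic F)/eqP].
by rewrite num_flag_tens num_flag_unit addn_eq0 => /andP[/eqP].
Qed.

Lemma num_flag_associated (M : smcat) (F : smfunctor (plus M) AggCyc)
    (φ ψ : arr_smc M) :
  associated φ ψ -> num_flag F ψ = num_flag F φ.
Proof.
move=> [κ iκ /(num_flag_isomorphic F) ->].
by rewrite num_flag_tens (num_flag_invertible F iκ) addn0.
Qed.

Lemma num_vert_hom (M : smcat) (F : smfunctor (plus M) AggCyc)
    (φ ψ : arr_smc M) :
  plus_hom φ ψ -> num_vert F ψ <= num_vert F φ.
Proof.
by move=> u; exact: card_vert_hom (sval (fmap F (u : @hom (plus M) φ ψ))).
Qed.

Lemma num_flag_hom (M : smcat) (F : smfunctor (plus M) AggCyc)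
    (φ ψ : arr_smc M) :
  plus_hom φ ψ -> num_flag F ψ <= num_flag F φ.
Proof.
by move=> u; exact: card_flag_hom (sval (fmap F (u : @hom (plus M) φ ψ))).
Qed.

(** The form in which fullness of an equivalence transports the existence of
    contractions and isomorphisms of aggregates to the plus construction. *)
Definition reflects_homs (C D : category) (F : functor C D) : Prop :=
  forall X Y : C, hom (F X) (F Y) -> inhabited (hom X Y).

(** If F φ is empty, it is isomorphic to the image of the unit object, so there is
    a morphism from the unit object to φ. *)
Lemma num_vert_eq0 (M : smcat) (F : smfunctor (plus M) AggCyc)
    (φ : arr_smc M) :
  reflects_homs F -> num_vert F φ = 0 -> invertible φ.
Proof.
move=> reflF v0.
have f0 : num_flag F φ = 0.
  by apply: eq_card0 => x; have := card0_eq v0 (bd x).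
have [s] : F (𝟙 : plus M) ≃ F φ.
  by apply: corolla_isomorphic; rewrite -/(num_vert F _) -/(num_flag F _) ?v0 ?f0
    ?(num_vert_unit F) ?(num_flag_unit F).
have [u] := reflF _ _ (fwd s).
exact: plus_hom_invertible u (invertible_unit _).
Qed.

(** The number of vertices cannot increase, so it is one all along a word
    representing the morphism, and in every tensor product all factors but one
    are invertible. *)
Lemma plus_hom_associated (M : smcat) (F : smfunctor (plus M) AggCyc)
    (φ ψ : arr_smc M) :
  reflects_homs F -> plus_hom φ ψ -> num_vert F φ = 1 -> num_vert F ψ = 1 ->
  associated φ ψ.
Proof.
move=> reflF; elim=> {φ ψ} [φ ψ /arr_isomorphic e|X Y Z g f|φ ψ χ b IHb a IHa|
    φ ψ φ' ψ' a IHa b IHb].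
- by move=> _ _; rewrite e; reflexivity.
- rewrite (num_vert_tens F (Arr g) (Arr f)) => e _.
  have [vf|vg] : num_vert F (Arr f) = 0 \/ num_vert F (Arr g) = 0 by lia.
    have {vf} if_ := num_vert_eq0 reflF vf.
    rewrite (comp_invertible_r g if_); symmetry.
    exact: (associated_tens_invertible (Arr g : arr_smc M) if_).
  have {vg} ig := num_vert_eq0 reflF vg.
  rewrite (comp_invertible_l f ig); symmetry.
  exact: (associated_invertible_tens (Arr f : arr_smc M) ig).
- move=> vφ vχ; have vψ : num_vert F ψ = 1.
    by have := num_vert_hom F a; have := num_vert_hom F b; lia.
  by transitivity ψ; auto.
- rewrite (num_vert_tens F φ ψ) (num_vert_tens F φ' ψ') => e e'.
  have la := num_vert_hom F a; have lb := num_vert_hom F b.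
  have [vs|vs] : num_vert F ψ = 0 \/ num_vert F φ = 0 by lia.
    have iψ : invertible (ψ : arr_smc M) by apply: (num_vert_eq0 reflF); lia.
    have iψ' : invertible (ψ' : arr_smc M) by apply: (num_vert_eq0 reflF); lia.
    transitivity φ; first by symmetry; exact: associated_tens_invertible.
    transitivity φ'; last exact: associated_tens_invertible.
    by apply: IHa; lia.
  have iφ : invertible (φ : arr_smc M) by apply: (num_vert_eq0 reflF); lia.
  have iφ' : invertible (φ' : arr_smc M) by apply: (num_vert_eq0 reflF); lia.
  transitivity ψ; first by symmetry; exact: associated_invertible_tens.
  transitivity ψ'; last exact: associated_invertible_tens.
  by apply: IHb; lia.
Qed.

(** Some letter of the word lowers the number of vertices, and it must be a
    γ_{a,b} with neither a nor b invertible. *)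
Lemma plus_hom_merging (M : smcat) (F : smfunctor (plus M) AggCyc)
    (φ ψ : arr_smc M) :
  reflects_homs F -> plus_hom φ ψ -> num_vert F ψ < num_vert F φ ->
  exists (X Y Z : M) (a : hom Y Z) (b : hom X Y),
    [/\ 0 < num_vert F (Arr a), 0 < num_vert F (Arr b),
        num_vert F (Arr (a ∘ b)) < num_vert F (Arr a) + num_vert F (Arr b),
        num_vert F (Arr a) + num_vert F (Arr b) <= num_vert F φ &
        num_flag F (Arr a) + num_flag F (Arr b) <= num_flag F φ].
Proof.
move=> reflF; elim=> {φ ψ} [φ ψ /arr_isomorphic e|X Y Z g f|φ ψ χ b IHb a IHa|
    φ ψ φ' ψ' a IHa b IHb].
- by rewrite (num_vert_isomorphic F e) ltnn.
- rewrite (num_vert_tens F (Arr g) (Arr f)) (num_flag_tens F (Arr g) (Arr f)).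
  move=> lt.
  exists X, Y, Z, g, f; split=> //; rewrite lt0n; apply/eqP => v0.
    have e := comp_invertible_l f (num_vert_eq0 reflF v0).
    by move: lt; rewrite v0 (num_vert_isomorphic F e) ltnn.
  have e := comp_invertible_r g (num_vert_eq0 reflF v0).
  by move: lt; rewrite v0 (num_vert_isomorphic F e) addn0 ltnn.
- have va := num_vert_hom F a; have fa := num_flag_hom F a; move=> lt.
  have [lta|ltb] :
      num_vert F ψ < num_vert F φ \/ num_vert F χ < num_vert F ψ by lia.
    exact: IHa lta.
  have [X [Y [Z [g [f [*]]]]]] := IHb ltb.
  by exists X, Y, Z, g, f; split=> //; lia.
- rewrite (num_vert_tens F φ ψ) (num_vert_tens F φ' ψ') (num_flag_tens F φ ψ).
  move=> lt.
  have [lta|ltb] :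
      num_vert F φ' < num_vert F φ \/ num_vert F ψ' < num_vert F ψ by lia.
    have [X [Y [Z [g [f [*]]]]]] := IHa lta.
    by exists X, Y, Z, g, f; split=> //; lia.
  have [X [Y [Z [g [f [*]]]]]] := IHb ltb.
  by exists X, Y, Z, g, f; split=> //; lia.
Qed.

(** Associativity of a family of operations is inherited by their images under a
    symmetric monoidal functor. *)
Lemma smf_assoc_ops (C D : smcat) (F : smfunctor C D) (A B E AB BE P Q : C)
    (k : hom P Q) (opr : hom (A ⊗ BE) P) (opBE : hom (B ⊗ E) BE)
    (opl : hom (AB ⊗ E) Q) (opAB : hom (A ⊗ B) AB) :
  k ∘ (opr ∘ ((idm A ⊠ opBE) ∘ assoc A B E)) ≈ opl ∘ (opAB ⊠ idm E) ->
  fmap F k ∘ (fmap F opr ∘ smf_tens F A BE)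
    ∘ (idm (F A) ⊠ (fmap F opBE ∘ smf_tens F B E)) ∘ assoc (F A) (F B) (F E)
  ≈ (fmap F opl ∘ smf_tens F AB E)
    ∘ ((fmap F opAB ∘ smf_tens F A B) ⊠ idm (F E)).
Proof.
move=> /(fmap_heq F); rewrite !fmap_comp => e.
have nat_l := smf_tens_nat F opAB (idm E).
have nat_r := smf_tens_nat F (idm A) opBE.
rewrite fmap_id in nat_l; rewrite fmap_id in nat_r.
have -> : idm (F A) ⊠ (fmap F opBE ∘ smf_tens F B E)
    ≈ (idm (F A) ⊠ fmap F opBE) ∘ (idm (F A) ⊠ smf_tens F B E).
  by rewrite -tensm_comp comp1m.
have -> : (fmap F opAB ∘ smf_tens F A B) ⊠ idm (F E)
    ≈ (fmap F opAB ⊠ idm (F E)) ∘ (smf_tens F A B ⊠ idm (F E)).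
  by rewrite -tensm_comp comp1m.
rewrite -!compA (compA (smf_tens F A BE)) nat_r (compA (smf_tens F AB E)) nat_l.
have assocF := smf_assoc F A B E; rewrite -!compA in assocF e *.
by rewrite -assocF (compA (fmap F opl)) -e !compA.
Qed.

Definition gamma_image (M D : smcat) (F : smfunctor (plus M) D) (X Y Z : M)
    (a : hom Y Z) (b : hom X Y) :
    hom (F (Arr a : plus M) ⊗ F (Arr b : plus M)) (F (Arr (a ∘ b) : plus M)) :=
  fmap F (plus_gamma a b :
      @hom (plus M) (arr_tens (Arr a) (Arr b)) (Arr (a ∘ b)))
  ∘ smf_tens F (Arr a) (Arr b).

Lemma gamma_image_assoc (M D : smcat) (F : smfunctor (plus M) D) (W X Y Z : M)
    (a : hom Y Z) (b : hom X Y) (c : hom W X) :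
  fmap F (plus_iso (arr_cast (compA a b c)) : @hom (plus M) (Arr _) (Arr _)) ∘
    gamma_image F a (b ∘ c) ∘ (idm (F (Arr a : plus M)) ⊠ gamma_image F b c) ∘
    assoc (F (Arr a : plus M)) (F (Arr b : plus M)) (F (Arr c : plus M))
  ≈ gamma_image F (a ∘ b) c ∘ (gamma_image F a b ⊠ idm (F (Arr c : plus M))).
Proof.
exact: (smf_assoc_ops F (plus_gammaA a b c)).
Qed.

Lemma eq_of_card_le1 (T : finType) (x y : T) : #|T| <= 1 -> x = y.
Proof. by move=> /fintype_le1P le1; rewrite [LHS](le1 y). Qed.

(** The vertices of a and b are merged along an edge, which needs a flag at each
    of them; there are at most two flags in total, and both are used up. *)
Lemma half_edge_pair (M : smcat) (F : smfunctor (plus M) AggCyc)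
    (φ ψ : arr_smc M) :
  reflects_homs F -> F φ ≃ half_edge ⊗ half_edge -> F ψ ≃ point ->
  exists (X Y Z : M) (a : hom Y Z) (b : hom X Y),
    [/\ num_vert F (Arr a) = 1, num_vert F (Arr b) = 1,
        num_flag F (Arr a) = 1, num_flag F (Arr b) = 1
      & num_vert F (Arr (a ∘ b)) <= 1 /\ num_flag F (Arr (a ∘ b)) = 0].
Proof.
move=> reflF eφ eψ.
have vφ : num_vert F φ = 2.
  by rewrite [LHS](card_vert_isomorphic eφ) card_sum card_unit.
have fφ : num_flag F φ = 2.
  by rewrite [LHS](card_flag_isomorphic eφ) card_sum card_unit.
have vψ : num_vert F ψ = 1.
  by rewrite [LHS](card_vert_isomorphic eψ) card_unit.
have [[s] [t]] := (eφ, eψ).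
have [u] := reflF φ ψ (bwd t ∘ join_half_edges ∘ s).
have [|X [Y [Z [a [b [va vb vab sv sf]]]]]] := plus_hom_merging reflF u.
  by rewrite vφ vψ.
exists X, Y, Z, a, b.
have [[xa _] [xb _]] := (card_gt0P va, card_gt0P vb).
set J := sval (gamma_image F a b).
have vab1 : #|vert (F (Arr (a ∘ b)))| <= 1 by rewrite -/(num_vert F _); lia.
have eJ : mV J (inl xa) = mV J (inr xb) by exact: eq_of_card_le1.
have gJ : generated basic_tree J := svalP _.
have [x bx ex] := merged_vertex_edge gJ (isT : inl xa != inr xb) eJ.
have [y by_ ey] := merged_vertex_edge gJ (isT : inr xb != inl xa) (esym eJ).
have fa : 0 < num_flag F (Arr a).
  by case: x bx {ex} => // x _; apply/card_gt0P; exists x.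
have fb : 0 < num_flag F (Arr b).
  by case: y by_ {ey} => // y _; apply/card_gt0P; exists y.
have nxy : x != y by apply/eqP => exy; move: bx; rewrite exy by_.
(* A flag of the image of a ∘ b would come from a third flag besides x and y. *)
have fab : num_flag F (Arr (a ∘ b)) = 0.
  apply/eqP; rewrite -leqn0 leqNgt; apply/negP => /card_gt0P[z _].
  have : #|[set x; y; mF J z]| <= 2.
    rewrite fφ in sf; apply: leq_trans (max_card _) _.
    by rewrite card_sum -/(num_flag F _) -/(num_flag F _).
  rewrite setUC cardsU1 cards2 nxy !inE.
  suff -> : (mF J z == x) || (mF J z == y) = false by [].
  apply/norP; split; apply/eqP => e; [move: ex|move: ey];
    by rewrite -e mI_mF eqxx.
by split; [lia..|split=> //; lia].
Qed.

Lemma no_half_edge_contraction (M : smcat) (F : smfunctor (plus M) AggCyc)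
    (φ ψ : arr_smc M) :
  reflects_homs F -> F φ ≃ half_edge ⊗ half_edge -> F ψ ≃ point -> False.
Proof.
move=> reflF eφ eψ.
have [X [Y [Z [a [b [va vb fa fb [vab fab]]]]]]] := half_edge_pair reflF eφ eψ.
have asc : associated (Arr a : arr_smc M) (Arr b).
  have [s] : F (Arr a : plus M) ≃ F (Arr b : plus M).
    by apply: corolla_isomorphic; rewrite -/(num_vert F _) -/(num_flag F _)
      ?va ?vb ?fa ?fb.
  have [u] := reflF _ _ (fwd s).
  exact: plus_hom_associated reflF u va vb.
have [W [c asc']] := associated_step asc.
have fbc : num_flag F (Arr (b ∘ c)) = 0 by rewrite (num_flag_associated F asc').
have [xa _] : exists x, x \in vert (F (Arr a)).
  by apply/card_gt0P; rewrite -/(num_vert F _) va.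
have [xb _] : exists x, x \in vert (F (Arr b)).
  by apply/card_gt0P; rewrite -/(num_vert F _) vb.
have [eV _ _] := gamma_image_assoc F a b c.
set y := mV (sval (gamma_image F b c)) (inl xb).
set f := fmap F (plus_iso (arr_cast (compA a b c)) :
    @hom (plus M) (Arr _) (Arr _))
  ∘ gamma_image F a (b ∘ c).
(* Evaluate both sides of associativity at the vertices of a and b; on the right
   they meet in the single vertex of the image of a ∘ b. *)
have e : mV (sval f) (inr y) = mV (sval f) (inl xa).
  have /= ea := eV (inl (inl xa)); have /= eb := eV (inl (inr xb)).
  rewrite [LHS]eb [RHS]ea; congr (mV _ (mV _ _)); congr (inl _).
  exact: eq_of_card_le1.
have [t bt _] := merged_vertex_edge (svalP f) (isT : inr y != inl xa) e.
case: t bt => // t _.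
by have := card0_eq fbc t.
Qed.

Theorem corollary5p18 : ~ is_standard_plus Fcyc.
Proof.
move=> [M [F [G [[η] [ε]]]]].
have reflF : reflects_homs F.
  by move=> φ ψ u; constructor; exact: (η ψ ∘ fmap G u ∘ bwd (η φ)).
have eF X : F (G X) ≃ X by constructor; exact: ε X.
exact: (no_half_edge_contraction reflF (eF (half_edge ⊗ half_edge)) (eF point)).
Qed.
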